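(* Let $1<p<k+1$, $\theta\in(0,\frac{\pi}{2})$ and $0<\gamma<\frac{2(p-1)}{k}$, and let $\phi\in C^\infty(\mathcal{C}_\theta)$ be positive. Then there exists a constant $C_0=C_0(\theta,k,p,\gamma,\phi)$ with the following property. Let $F$ be a symmetric, $k$-homogeneous, smooth curvature function, and suppose $s$ is an even, smooth, strictly convex solution of $$F(\tau^\sharp[s])=s^{p-1}\phi\ \text{ in }\mathcal{C}_\theta,\qquad \nabla_\mu s=\cot\theta\, s\ \text{ on }\partial\mathcal{C}_\theta .$$ Then $$\frac{|\nabla s|^2}{s^\gamma}\le C_0\Big(\max_{\mathcal{C}_\theta}s\Big)^{2-\gamma}\qquad\text{on }\mathcal{C}_\theta .$$
   Context: Let $n\ge1$, let $e_1,\dots,e_{n+1}$ be the standard orthonormal basis of $\mathbb{R}^{n+1}$, and $\mathbb{R}^{n+1}_+=\{x: x_{n+1}>0\}$, $\partial\mathbb{R}^{n+1}_+=\{x:x_{n+1}=0\}$. For $\theta\in(0,\pi)$ put $\mathbb{S}^n_\theta=\{x\in\mathbb{S}^n:\langle x,e_{n+1}\rangle\ge\cos\theta\}$ and $\mathcal{C}_\theta=\mathbb{S}^n_\theta-\cos\theta\,e_{n+1}$ (a compact smooth hypersurface with boundary). On $\mathcal{C}_\theta$, $g$ is the round metric, $\nabla$ its Levi-Civita connection (and gradient), $\nabla^2$ the covariant Hessian, and $\mu$ is the outward unit conormal of $\partial\mathcal{C}_\theta$ in $\mathcal{C}_\theta$. For $f\in C^2(\mathcal{C}_\theta)$, $\tau[f]=\nabla^2f+f\,g$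 and $\tau^\sharp[f]=g^{-1}\cdot\tau[f]$, a symmetric endomorphism of $T\mathcal{C}_\theta$. Curvature function: $F$ is a smooth, positive, symmetric function on the open positive cone $\{\lambda\in\mathbb{R}^n:\lambda_i>0\ \forall i\}$, with $\partial F/\partial\lambda_i>0$ for all $i$; it is $k$-homogeneous if $F(t\lambda)=t^kF(\lambda)$ for $t>0$. For a positive definite symmetric endomorphism $A$, $F(A)$ denotes $F$ evaluated at the eigenvalues of $A$. Evenness: let $\mathcal{R}(x_1,\dots,x_n,x_{n+1})=(-x_1,\dots,-x_n,x_{n+1})$. A function $\varphi:\mathcal{C}_\theta\to\mathbb{R}$ is even if $\varphi\circ\mathcal{R}=\varphi$. A smooth solution $s$ is strictly convex if it is the capillary support function of a strictly convex capillary hypersurface with contact angle $\theta$; equivalently, $s$ satisfies the boundary condition above and $\tau[s]$ is positive definite on $\mathcal{C}_\theta$. (An even strictly convex $s$ is positive.) Here a smooth, compact, connected, orientable hypersurface $\Sigma\subset\overline{\mathbb{R}^{n+1}_+}$ with $\mathrm{int}(\Sigma)\subset\mathbb{R}^{n+1}_+$, $\partial\Sigma\subset\partial\mathbb{R}^{n+1}_+$ is a capillary hypersurface with contact angle $\theta$ if $\langle\nu,e_{n+1}\rangle=\cos\theta$ on $\partial\Sigma$, $\nu$ being its outer unit normal; it is strictly convex if the region enclosed by $\Sigma$ and $\partial\mathbb{R}^{n+1}_+$ is a convex body and the second fundamental form of $\Sigma$ is positive definite; then $\tilde\nu=\nu-\cos\theta\,e_{n+1}:\Sigma\to\mathcal{C}_\theta$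 is a diffeomorphism and the capillary support function is $s(\zeta)=\langle\tilde\nu^{-1}(\zeta),\zeta+\cos\theta\,e_{n+1}\rangle$. *)

(* Defs.v *)
From HB Require Import structures.
From mathcomp Require Import all_boot all_order all_algebra perm.
From mathcomp Require Import all_classical all_reals all_analysis.

Set Implicit Arguments.
Unset Strict Implicit.
Unset Printing Implicit Defensive.

Import Order.TTheory GRing.Theory Num.Theory.
Import numFieldNormedType.Exports.

Local Open Scope classical_set_scope.
Local Open Scope ring_scope.

(* The library norm on 'rV[R]_m is the sup norm;
   it induces the usual topology and the usual derivatives, but all metric
   notions below go through the Euclidean product [dot]. *)

Definition dot (R : realType) (m : nat) (u v : 'rV[R]_m) : R :=
  \sum_(i < m) u 0 i * v 0 i.

Definition basis_vec (R : realType) (m : nat) (i : 'I_m) : 'rV[R]_m :=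
  delta_mx 0 i.

Definition e_last (R : realType) (n : nat) : 'rV[R]_n.+1 :=
  basis_vec R (@ord_max n).

Definition grad (R : realType) (m : nat) (f : 'rV[R]_m -> R) (x : 'rV[R]_m) :
    'rV[R]_m :=
  \row_(i < m) 'D_(basis_vec R i) f x.

(* f is C^infinity on U (meant for U open): every iterated directional
   derivative of f is Frechet differentiable, hence continuous, on U. *)
Definition smooth_on (R : realType) (m : nat) (U : set 'rV[R]_m)
    (f : 'rV[R]_m -> R) : Prop :=
  forall (vs : seq 'rV[R]_m) (x : 'rV[R]_m), U x ->
    differentiable
      (foldr (fun (v : 'rV[R]_m) (h : 'rV[R]_m -> R) => 'D_v h) f vs) x.

Definition sphere_cap (R : realType) (n : nat) (theta : R) :
    set 'rV[R]_n.+1 :=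
  [set x | dot x x = 1 /\ cos theta <= dot x (e_last R n)].

Definition cap (R : realType) (n : nat) (theta : R) : set 'rV[R]_n.+1 :=
  [set x - cos theta *: e_last R n | x in @sphere_cap R n theta].

Definition cap_boundary (R : realType) (n : nat) (theta : R) :
    set 'rV[R]_n.+1 :=
  [set z | cap theta z /\ dot z (e_last R n) = 0].

(* A smooth function on the compact hypersurface with boundary [cap theta] is
   the restriction of a function that is smooth in a neighbourhood of it in
   R^(n+1); we carry such a representative f. [nabla] and [hess] below,
   evaluated on [cap theta] and on tangent vectors, do not depend on the
   representative (at the boundary, by continuity). *)
Definition smooth_cap (R : realType) (n : nat) (theta : R)
    (f : 'rV[R]_n.+1 -> R) : Prop :=
  exists U : set 'rV[R]_n.+1,
    [/\ open U, cap theta `<=` U & smooth_on U f].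

(* On [cap theta] this is the unit normal z + cos(theta) e_(n+1); the same
   formula extends it to R^(n+1), which allows differentiating
   [tangent_proj theta x (V x)] in x. *)
Definition normal (R : realType) (n : nat) (theta : R) (z : 'rV[R]_n.+1) :
    'rV[R]_n.+1 :=
  z + cos theta *: e_last R n.

Definition tangent (R : realType) (n : nat) (theta : R)
    (z X : 'rV[R]_n.+1) : Prop :=
  dot X (normal theta z) = 0.

Definition tangent_proj (R : realType) (n : nat) (theta : R)
    (z v : 'rV[R]_n.+1) : 'rV[R]_n.+1 :=
  v - dot v (normal theta z) *: normal theta z.

(* The Levi-Civita connection of the induced metric of a hypersurface of
   R^(n+1): the tangential part of the flat derivative. *)
Definition covariant (R : realType) (n : nat) (theta : R)
    (V : 'rV[R]_n.+1 -> 'rV[R]_n.+1) (z X : 'rV[R]_n.+1) : 'rV[R]_n.+1 :=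
  tangent_proj theta z ('D_X V z).

Definition nabla (R : realType) (n : nat) (theta : R)
    (f : 'rV[R]_n.+1 -> R) (z : 'rV[R]_n.+1) : 'rV[R]_n.+1 :=
  tangent_proj theta z (grad f z).

Definition hess (R : realType) (n : nat) (theta : R)
    (f : 'rV[R]_n.+1 -> R) (z X Y : 'rV[R]_n.+1) : R :=
  dot (covariant theta (nabla theta f) z X) Y.

Definition tau (R : realType) (n : nat) (theta : R)
    (f : 'rV[R]_n.+1 -> R) (z X Y : 'rV[R]_n.+1) : R :=
  hess theta f z X Y + f z * dot X Y.

Definition tau_sharp (R : realType) (n : nat) (theta : R)
    (f : 'rV[R]_n.+1 -> R) (z X : 'rV[R]_n.+1) : 'rV[R]_n.+1 :=
  covariant theta (nabla theta f) z X + f z *: X.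

Lemma tau_sharpE (R : realType) (n : nat) (theta : R)
    (f : 'rV[R]_n.+1 -> R) (z X Y : 'rV[R]_n.+1) :
  dot (tau_sharp theta f z X) Y = tau theta f z X Y.
Proof.
rewrite /tau_sharp /tau /hess /dot mulr_sumr -big_split /=.
by apply: eq_bigr => i _; rewrite !mxE mulrDl mulrA.
Qed.

(* mu is the outward unit conormal at the boundary point z: a unit vector
   tangent to the cap, orthogonal to the tangent space of the boundary, and
   pointing out of the half space x_(n+1) >= 0 that contains the cap. *)
Definition outward_conormal (R : realType) (n : nat) (theta : R)
    (z mu : 'rV[R]_n.+1) : Prop :=
  [/\ tangent theta z mu,
      dot mu mu = 1,
      (forall X : 'rV[R]_n.+1,
         tangent theta z X -> dot X (e_last R n) = 0 -> dot mu X = 0)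
    & dot mu (e_last R n) < 0].

Definition robin (R : realType) (n : nat) (theta : R)
    (s : 'rV[R]_n.+1 -> R) : Prop :=
  forall z mu : 'rV[R]_n.+1,
    cap_boundary theta z -> outward_conormal theta z mu ->
    dot (nabla theta s z) mu = cos theta / sin theta * s z.

Definition strictly_convex (R : realType) (n : nat) (theta : R)
    (s : 'rV[R]_n.+1 -> R) : Prop :=
  robin theta s /\
  forall z X : 'rV[R]_n.+1,
    cap theta z -> tangent theta z X -> X != 0 -> 0 < tau theta s z X X.

Definition reflect_horiz (R : realType) (n : nat) (x : 'rV[R]_n.+1) :
    'rV[R]_n.+1 :=
  \row_(i < n.+1) (if i == ord_max then x 0 i else - x 0 i).

Definition even_on_cap (R : realType) (n : nat) (theta : R)
    (f : 'rV[R]_n.+1 -> R) : Prop :=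
  forall z : 'rV[R]_n.+1, cap theta z -> f (reflect_horiz z) = f z.

Definition pos_cone (R : realType) (n : nat) : set 'rV[R]_n :=
  [set l | forall i : 'I_n, 0 < l 0 i].

Record curvature_function (R : realType) (n : nat) (F : 'rV[R]_n -> R) :
    Prop := CurvatureFunction {
  curv_smooth : smooth_on (@pos_cone R n) F;
  curv_pos : forall l : 'rV[R]_n, pos_cone l -> 0 < F l;
  curv_sym : forall (l : 'rV[R]_n) (p : 'S_n),
    pos_cone l -> F (col_perm p l) = F l;
  curv_mono : forall (l : 'rV[R]_n) (i : 'I_n),
    pos_cone l -> 0 < 'D_(basis_vec R i) F l }.

Definition homogeneous (R : realType) (n : nat) (k : R)
    (F : 'rV[R]_n -> R) : Prop :=
  forall (t : R) (l : 'rV[R]_n), 0 < t -> pos_cone l ->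
    F (t *: l) = t `^ k * F l.

(* l lists, with multiplicity, the eigenvalues of the self-adjoint
   endomorphism A of the n-dimensional tangent space at z. *)
Definition eigenvalues (R : realType) (n : nat) (theta : R)
    (z : 'rV[R]_n.+1) (A : 'rV[R]_n.+1 -> 'rV[R]_n.+1) (l : 'rV[R]_n) : Prop :=
  exists E : 'I_n -> 'rV[R]_n.+1,
    [/\ forall i, tangent theta z (E i),
        forall i j, dot (E i) (E j) = (i == j)%:R
      & forall i, A (E i) = l 0 i *: E i].

(* F(A) = c. The list l exists by the spectral theorem and is unique up to
   order, which is irrelevant as F is symmetric. *)
Definition curvature_eval (R : realType) (n : nat) (theta : R)
    (F : 'rV[R]_n -> R) (z : 'rV[R]_n.+1)
    (A : 'rV[R]_n.+1 -> 'rV[R]_n.+1) (c : R) : Prop :=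
  exists2 l : 'rV[R]_n, eigenvalues theta z A l & F l = c.

Definition solution (R : realType) (n : nat) (theta p : R)
    (phi : 'rV[R]_n.+1 -> R) (F : 'rV[R]_n -> R)
    (s : 'rV[R]_n.+1 -> R) : Prop :=
  (forall z : 'rV[R]_n.+1, cap theta z ->
     curvature_eval theta F z (tau_sharp theta s z)
       (s z `^ (p - 1) * phi z)) /\
  robin theta s.

(* The cap is compact and nonempty, so for continuous f this supremum is a
   maximum. *)
Definition max_cap (R : realType) (n : nat) (theta : R)
    (f : 'rV[R]_n.+1 -> R) : R :=
  sup (f @` cap theta).

(* Main.v *)
Require Import Defs.
From HB Require Import structures.
From mathcomp Require Import all_boot all_order all_algebra perm.
From mathcomp Require Import all_classical all_reals all_analysis.
From mathcomp Require Import ring lra.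

(** Why the estimate holds.

    Extend [s] to a function [S] which is homogeneous of degree one on a cone of
    R^(n+1).  This is the support function of the hypersurface: at a unit normal
    [x] its gradient [nabla s + s x] is the position vector, and its flat Hessian
    on the tangent space of the sphere is [tau s] ([tau_sharp_support]).  Covariant
    derivatives thus become directional derivatives, which commute, and the
    boundary condition becomes [D_e S = 0], where [e] is the vertical unit vector
    ([robin_support]).  The same passage and the maximum principle give the
    positivity of [S] ([support_pos]).

    Put [a = gamma / 2], [beta = cos theta / sin theta ^ 2] and
    [W = grad S + beta S e].  Since [|nabla s| <= |grad S|], it is enough to show
    that [|W| <= K S] at a point [x] where [|W| / S ^ a] attains its maximum [L]
    over the cap ([field_at_max]); as [a < 1], this yields
    [|W| <= K S ^ a M ^ (1 - a)] everywhere, with [M] the maximum of [S].  Freeze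
    the unit vector [w] in the direction of [W] at [x].  Then
    [w . W - L S ^ a = D_w S + b S - L S ^ a], with [b = beta (w . e)], is at most
    [0] on the cap and vanishes at [x].

    If [x] is a boundary point, then [w] is orthogonal to the conormal by the choice
    of [beta], and the conormal is a principal direction ([boundary_principal]).
    The derivative of the test function along [e - cos theta x], which points
    inward, is therefore [cos theta (a |W| - b S)].  It is nonpositive at a maximum
    and [cos theta > 0], so [a |W| <= b S].

    If [x] is an interior point, the second derivative tests along the great
    circles tangent to an eigenframe [E_i] of [tau s] are added with the weights
    [F_i], the derivatives of [F] at the eigenvalues.  Four facts are used: the
    third-order terms add up to the derivative of [S ^ (p - 1) phi] in the tangential
    part of [w] ([linearised_equation]) and a radial term; the latter and the
    second-order terms are multiples of [k S ^ (p - 1) phi] by Euler's relation; the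
    square of the first derivatives has a favourable sign because [a < 1]; and the
    terms without derivatives carry the factor [a |W| - b S], positive if [|W|] is
    large with respect to [S].  What remains is [(p - 1 - a k) |W| <= const S], with a
    constant depending on [theta], [k], [p] and the logarithmic derivative of
    [phi]; and [p - 1 - a k > 0] is the hypothesis on [gamma].

    The equation is differentiated through the eigenvalues of the Hessian, which
    may be multiple; [eigenvalues_perturbation] provides their first-order expansion
    in the direction [w], with respect to a limit eigenframe at [x]. *)

Set Implicit Arguments.
Unset Strict Implicit.
Unset Printing Implicit Defensive.

Import Order.TTheory GRing.Theory Num.Theory.
Import numFieldNormedType.Exports.

Local Open Scope classical_set_scope.
Local Open Scope ring_scope.

(** * Directional derivatives *)

Section DirectionalDerivatives.
Context {R : realType}.

Lemma differentiableP_eps (V W : normedModType R) (f : V -> W) (x : V) :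
  differentiable f x -> forall e, 0 < e ->
  \forall h \near (0 : V), `|f (h + x) - f x - 'd f x h| <= e * `|h|.
Proof.
move=> /diff_locallyP [_ /eqaddoP H] e e0.
by near do rewrite -addrA -opprD; apply: H.
Unshelve. all: by end_near. Qed.

Lemma near_eq_differentiable (V W : normedModType R) (f g : V -> W) (x : V) :
  (\near x, f x = g x) -> differentiable f x -> differentiable g x.
Proof.
move=> fg /diff_locallyP [dfc /eqaddoP dfx].
have E : g \o shift x = cst (g x) + 'd f x +o_ 0 id.
  apply/eqaddoP => e e0; near=> y.
  have E1 : f (y + x) = g (y + x).
    by near: y; move: fg; rewrite (near_shift 0) subr0.
  have -> : (g \o shift x - (cst (g x) + 'd f x)) y =
            (f \o shift x - (cst (f x) + 'd f x)) y.
    by rewrite !fctE /= E1 (nbhs_singleton fg).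
  by near: y; apply: dfx.
have Ed := diff_unique dfc E.
by apply/diff_locallyP; rewrite Ed.
Unshelve. all: by end_near. Qed.

Lemma derive_dirD (V W : normedModType R) (f : V -> W) (x u v : V) :
  differentiable f x -> 'D_(u + v) f x = 'D_u f x + 'D_v f x.
Proof. by move=> df; rewrite !deriveE // linearD. Qed.

Lemma derive_dirZ (V W : normedModType R) (f : V -> W) (x v : V) (a : R) :
  differentiable f x -> 'D_(a *: v) f x = a *: 'D_v f x.
Proof. by move=> df; rewrite !deriveE // linearZ. Qed.

Lemma derive_chain (U V W : normedModType R) (g : U -> V) (f : V -> W)
    (x v : U) :
  differentiable g x -> differentiable f (g x) ->
  'D_v (f \o g) x = 'D_('D_v g x) f (g x).
Proof.
move=> dg df; rewrite deriveE; last exact: differentiable_comp.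
by rewrite diff_comp //= !deriveE.
Qed.

Lemma derive_dot m (f : 'rV[R]_m -> R) (x v : 'rV[R]_m) :
  differentiable f x -> 'D_v f x = dot v (grad f x).
Proof.
move=> df; rewrite deriveE // {1}[v]row_sum_delta linear_sum /dot.
by apply: eq_bigr => i _; rewrite linearZ /= mxE deriveE.
Qed.

Lemma differentiable_rV (V : normedModType R) m (g : V -> 'rV[R]_m) (x : V) :
  (forall j, differentiable (fun y => g y 0 j) x) -> differentiable g x.
Proof.
move=> dg.
have -> : g = \sum_(j < m) (fun y => g y 0 j *: (delta_mx 0 j : 'rV[R]_m)).
  by rewrite funeqE => y; rewrite fct_sumE; exact: row_sum_delta.
by apply: differentiable_sum => j; apply: differentiableZl.
Qed.

Lemma derive_coord (V : normedModType R) m (g : V -> 'rV[R]_m) (x v : V) j :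
  differentiable g x -> ('D_v g x) 0 j = 'D_v (fun y => g y 0 j) x.
Proof. by move=> dg; rewrite derive_mx ?mxE //; apply: diff_derivable. Qed.

End DirectionalDerivatives.

Section Symmetry.
Context {R : realType} {V : normedModType R}.
Implicit Types (f : V -> R) (x u v : V).

Lemma is_derive_line f x u (t : R) :
  differentiable f (x + t *: u) ->
  is_derive t 1 (fun r : R => f (x + r *: u)) ('D_u f (x + t *: u)).
Proof.
move=> df.
have Dg : is_diff t (fun r : R => x + r *: u) (cst 0 + ( *:%R^~ u)).
  exact: is_diffD.
have dg : differentiable (fun r : R => x + r *: u) t by [].
apply: DeriveDef; first exact/derivable1_diffP/(differentiable_comp dg df).
rewrite (derive_chain _ dg df) [X in 'D_X f _]deriveE // diff_val.
by rewrite !fctE /= add0r scale1r.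
Qed.

Let second_diff f x u v (h : R) :=
  f (x + h *: v + h *: u) - f (x + h *: u) - (f (x + h *: v) - f x).

(* By the mean value theorem the second difference is [h] times an increment
   of [D_u f], which the Frechet derivative of [D_u f] at [x] approximates. *)
Let second_diff_approx f x u v (e : R) :
  (\near x, differentiable f x) -> differentiable ('D_u f) x -> 0 < e ->
  exists2 d, 0 < d & forall h, 0 < h < d ->
    `|second_diff f x u v h - h ^+ 2 * 'D_v ('D_u f) x| <= e * h ^+ 2.
Proof.
move=> df ddf e0.
(* [h * N] dominates all increments used below; the [1] keeps [N] positive. *)
pose N := `|u| + `|v| + 1.
have N0 : 0 < N by rewrite ltr_wpDl // addr_ge0.
pose e' := e / (2 * N).
have e'0 : 0 < e' by rewrite divr_gt0 // mulr_gt0.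
have df0 : \forall k \near (0 : V), differentiable f (k + x).
  by move: df; rewrite (near_shift 0) subr0.
have [d /= d0 Hd] : exists2 d, 0 < d & forall k : V, `|k| < d ->
    differentiable f (k + x) /\
    `|'D_u f (k + x) - 'D_u f x - 'd ('D_u f) x k| <= e' * `|k|.
  have : \forall k \near (0 : V), differentiable f (k + x) /\
      `|'D_u f (k + x) - 'D_u f x - 'd ('D_u f) x k| <= e' * `|k|.
    by apply: filterS2 df0 (differentiableP_eps ddf e'0) => k; split.
  move=> /nbhs_ballP[d /= d0 Hd]; exists d => // k kd.
  by apply: Hd; rewrite -ball_normE /= sub0r normrN.
exists (d / N); first by rewrite divr_gt0.
move=> h /andP[h0]; rewrite ltr_pdivlMr // => hN.
have small r : 0 <= r <= h -> `|r *: u| <= h * N /\ `|h *: v + r *: u| <= h * N.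
  move=> /andP[r0 rh].
  have H1 : `|r *: u| <= h * `|u| by rewrite normrZ ger0_norm // ler_wpM2r.
  split; first by apply: (le_trans H1); rewrite ler_pM2l // /N -addrA lerDl addr_ge0.
  apply: (le_trans (ler_normD _ _)).
  rewrite normrZ (gtr0_norm h0).
  apply: (le_trans (lerD (lexx _) H1)).
  by rewrite -mulrDr ler_pM2l // /N addrC lerDl.
pose F := fun r : R => f (x + h *: v + r *: u) - f (x + r *: u).
have HF r : r \in `[0, h] -> is_derive r 1 F
    ('D_u f (x + h *: v + r *: u) - 'D_u f (x + r *: u)).
  rewrite in_itv /= => /small[s1 s2]; apply: is_deriveB; apply: is_derive_line.
    rewrite -addrA addrC; apply: (Hd _ _).1; exact: le_lt_trans s2 hN.
  by rewrite addrC; apply: (Hd _ _).1; exact: le_lt_trans s1 hN.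
have HFo (r : R) : r \in `]0, h[ -> is_derive r 1 F
    ('D_u f (x + h *: v + r *: u) - 'D_u f (x + r *: u)).
  by move=> rI; apply: HF; exact: subset_itv_oo_cc.
have [|r rI] := MVT_segment (ltW h0) HFo.
  apply: derivable_within_continuous => r /HF Hr.
  exact: ex_derive.
rewrite subr0 in_itv /= in rI *; move=> E.
have -> : second_diff f x u v h = F h - F 0.
  by rewrite /second_diff /F !scale0r !addr0.
rewrite E (deriveE _ ddf) expr2 -mulrA [_ * h]mulrC -mulrBr normrM (gtr0_norm h0).
rewrite mulrA mulrC ler_pM2r //.
have [s1 s2] := small r rI.
have [_ H1] := Hd _ (le_lt_trans s1 hN).
have [_ H2] := Hd _ (le_lt_trans s2 hN).
rewrite [x + r *: u]addrC -[x + _ + _]addrA [x + (_ + _)]addrC.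
have -> : 'D_u f (h *: v + r *: u + x) - 'D_u f (r *: u + x) - h * 'd ('D_u f) x v
  = ('D_u f (h *: v + r *: u + x) - 'D_u f x - 'd ('D_u f) x (h *: v + r *: u))
   - ('D_u f (r *: u + x) - 'D_u f x - 'd ('D_u f) x (r *: u)).
  by rewrite !linearD !linearZ /= /GRing.scale /=; ring.
apply: (le_trans (ler_normB _ _)).
apply: (le_trans (lerD H2 H1)).
apply: (@le_trans _ _ (e' * (h * N) + e' * (h * N))).
  by apply: lerD; rewrite ler_pM2l.
rewrite /e' le_eqVlt; apply/orP; left; apply/eqP; field.
by rewrite gt_eqF.
Qed.

(** Equality of mixed second derivatives, at a point where both first
    derivatives are differentiable: the second difference in the directions
    [u] and [v] is symmetric in them, and by the mean value theorem it is
    asymptotic to either mixed derivative. *)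
Lemma derive_comm f x u v :
  (\near x, differentiable f x) -> differentiable ('D_u f) x ->
  differentiable ('D_v f) x -> 'D_v ('D_u f) x = 'D_u ('D_v f) x.
Proof.
move=> df du dv; apply/eqP; rewrite -subr_eq0 -normr_le0.
apply/ler_addgt0Pl => e e0; rewrite addr0.
have e20 : 0 < e / 2 by rewrite divr_gt0.
have [d1 d10 H1] := second_diff_approx v df du e20.
have [d2 d20 H2] := second_diff_approx u df dv e20.
pose h := Num.min d1 d2 / 2.
have m0 : 0 < Num.min d1 d2 by rewrite lt_min d10 d20.
have h0 : 0 < h by rewrite divr_gt0.
have hm : h < Num.min d1 d2 by rewrite /h; lra.
have [hd1 hd2] : h < d1 /\ h < d2 by move: hm; rewrite lt_min => /andP.
have {}H1 := H1 h; have {}H2 := H2 h.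
rewrite h0 hd1 in H1; rewrite h0 hd2 in H2.
have {}H1 := H1 isT; have {}H2 := H2 isT.
have E : second_diff f x v u h = second_diff f x u v h.
  rewrite /second_diff; have -> : x + h *: u + h *: v = x + h *: v + h *: u.
    by rewrite addrAC.
  ring.
rewrite E in H2.
have h20 : 0 < h ^+ 2 by rewrite exprn_gt0.
rewrite -(ler_pM2l h20) -[X in X * `|_|]gtr0_norm // -normrM.
set A := second_diff f x u v h in H1 H2.
have -> : h ^+ 2 * ('D_v ('D_u f) x - 'D_u ('D_v f) x) =
  (A - h ^+ 2 * 'D_u ('D_v f) x) - (A - h ^+ 2 * 'D_v ('D_u f) x).
  by move: ('D_v ('D_u f) x) ('D_u ('D_v f) x) => q1 q2; ring.
apply: (le_trans (ler_normB _ _)).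
by apply: (le_trans (lerD H2 H1)); rewrite -mulrDl -splitr mulrC.
Qed.

End Symmetry.

(** * Functions of finite smoothness *)

Section FiniteSmoothness.
Context {R : realType} {m : nat}.
Local Notation V := 'rV[R]_m.
Implicit Types (U : set V) (f g : V -> R).

(** Class C^k, with one more order of Frechet differentiability and directional
    derivatives in place of multi-indices: in this form stability under products
    and compositions is a direct induction on [k]. *)
Fixpoint cdiff (k : nat) U f : Prop :=
  (forall x, U x -> differentiable f x) /\
  (if k is k'.+1 then forall v, cdiff k' U ('D_v f) else True).

Lemma cdiff_differentiable k U f x : cdiff k U f -> U x -> differentiable f x.
Proof. by case: k => [|k] [H _]; exact: H. Qed.

Lemma cdiff_derive k U f v : cdiff k.+1 U f -> cdiff k U ('D_v f).
Proof. by move=> [_ H]; exact: H. Qed.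

Lemma cdiffW k U f : cdiff k.+1 U f -> cdiff k U f.
Proof.
elim: k f => [|k IH] f [H1 H2]; split => //.
by move=> v; apply: IH.
Qed.

Lemma cdiffS k (W W' : set V) f : W `<=` W' -> cdiff k W' f -> cdiff k W f.
Proof.
move=> WW'; elim: k f => [|k IH] f [f1 f2]; first by split => // x /WW'; exact: f1.
by split=> [x /WW'|v]; [exact: f1 | exact/IH/f2].
Qed.

Lemma near_open U f g x : open U -> {in U, f =1 g} -> U x -> \near x, f x = g x.
Proof.
move=> oU fg Ux; have := open_nbhs_nbhs (conj oU Ux).
by apply: filterS => y Uy; apply: fg; rewrite inE.
Qed.

Lemma cdiff_eq k U f g : open U -> {in U, f =1 g} -> cdiff k U f -> cdiff k U g.
Proof.
move=> oU; elim: k f g => [|k IH] f g fg [H1 H2]; split => //.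
- by move=> x Ux; apply: near_eq_differentiable (H1 x Ux); exact: near_open fg Ux.
- by move=> x Ux; apply: near_eq_differentiable (H1 x Ux); exact: near_open fg Ux.
- move=> v; apply: IH (H2 v) => x; rewrite inE => Ux.
  by apply: near_eq_derive; exact: near_open fg Ux.
Qed.

Lemma cdiff_cst k U (a : R) : cdiff k U (fun=> a).
Proof.
elim: k a => [|k IH] a; split => //.
move=> v; suff -> : 'D_v (fun=> a : R) = fun=> 0 by [].
by rewrite funeqE => x; rewrite derive_cst.
Qed.

Lemma derive_coordE (x v : V) j : 'D_v (fun y : V => y 0 j : R) x = v 0 j.
Proof. by rewrite -(@derive_coord _ _ _ id) // derive_id. Qed.

Lemma cdiff_coord k U j : cdiff k U (fun x => x 0 j).
Proof.
case: k => [|k]; split => //; try by move=> x _; exact: differentiable_coord.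
move=> v; suff -> : 'D_v (fun y : V => y 0 j : R) = fun=> v 0 j by exact: cdiff_cst.
by rewrite funeqE => x; rewrite derive_coordE.
Qed.

Lemma cdiffD k U f g : open U -> cdiff k U f -> cdiff k U g ->
  cdiff k U (fun x => f x + g x).
Proof.
move=> oU; elim: k f g => [|k IH] f g [f1 f2] [g1 g2]; split => //.
- by move=> x Ux; apply: differentiableD; [exact: f1 | exact: g1].
- by move=> x Ux; apply: differentiableD; [exact: f1 | exact: g1].
- move=> v; apply: cdiff_eq (IH _ _ (f2 v) (g2 v)) => // x; rewrite inE => Ux.
  by rewrite -deriveD //; apply: diff_derivable; [exact: f1 | exact: g1].
Qed.

Lemma cdiffM k U f g : open U -> cdiff k U f -> cdiff k U g ->
  cdiff k U (fun x => f x * g x).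
Proof.
move=> oU; elim: k f g => [|k IH] f g F G; move: (F) (G) => [f1 f2] [g1 g2];
  split => //.
- by move=> x Ux; apply: differentiableM; [exact: f1 | exact: g1].
- by move=> x Ux; apply: differentiableM; [exact: f1 | exact: g1].
- move=> v; have H1 := IH _ _ (cdiffW F) (g2 v).
  have H2 := IH _ _ (cdiffW G) (f2 v).
  apply: cdiff_eq (cdiffD oU H1 H2) => // x; rewrite inE => Ux.
  by apply/esym/(@deriveM _ _ f g); apply: diff_derivable; [exact: f1 | exact: g1].
Qed.

Lemma cdiff_sum k U n (f : 'I_n -> V -> R) : open U ->
  (forall i, cdiff k U (f i)) -> cdiff k U (fun x => \sum_(i < n) f i x).
Proof.
move=> oU H.
have -> : (fun x => \sum_(i < n) f i x) = \sum_(i < n) f i.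
  by rewrite funeqE => x; rewrite fct_sumE.
elim/big_ind : _ => //; first exact: cdiff_cst.
by move=> g h; apply: cdiffD.
Qed.

Lemma differentiable_powR (W : normedModType R) (f : W -> R) (a : R) (x : W) : differentiable f x -> 0 < f x ->
  differentiable (fun y => f y `^ a) x.
Proof.
move=> df f0; have dp := is_derive1_powR a f0.
have dp' : differentiable (fun r : R => r `^ a) (f x) by apply/derivable1_diffP.
exact: (differentiable_comp df dp').
Qed.

Lemma derive_powR (W : normedModType R) (f : W -> R) (a : R) (x v : W) : differentiable f x -> 0 < f x ->
  'D_v (fun y => f y `^ a) x = a * f x `^ (a - 1) * 'D_v f x.
Proof.
move=> df f0; have dp := is_derive1_powR a f0.
have dp' : differentiable (fun r : R => r `^ a) (f x) by apply/derivable1_diffP.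
rewrite (derive_chain _ df dp') -[X in derive _ _ X]mulr1.
by rewrite (derive_dirZ _ _ dp') (derive_val (is_derive:=dp)) /GRing.scale /= mulrC.
Qed.

Lemma cdiff_powR k U f (a : R) : open U -> (forall x, U x -> 0 < f x) ->
  cdiff k U f -> cdiff k U (fun x => f x `^ a).
Proof.
move=> oU f0; elim: k a => [|k IH] a F; move: (F) => [f1 f2]; split => //.
- by move=> x Ux; apply: differentiable_powR; [exact: f1 | exact: f0].
- by move=> x Ux; apply: differentiable_powR; [exact: f1 | exact: f0].
- move=> v; have H := cdiffM oU (cdiffM oU (cdiff_cst k U a)
    (IH (a - 1) (cdiffW F))) (f2 v).
  apply: cdiff_eq H => // x; rewrite inE => Ux.
  by rewrite derive_powR //; [exact: f1 | exact: f0].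
Qed.

Lemma derive_comp_rV n (g : V -> 'rV[R]_n) (f : 'rV[R]_n -> R) x v :
  differentiable g x -> differentiable f (g x) ->
  'D_v (f \o g) x =
    \sum_(j < n) 'D_(basis_vec R j) f (g x) * 'D_v (fun y => g y 0 j) x.
Proof.
move=> dg df; rewrite (derive_chain _ dg df) (derive_dot _ df) /dot.
by apply: eq_bigr => j _; rewrite derive_coord // mxE mulrC.
Qed.

End FiniteSmoothness.

Lemma cdiff_comp (R : realType) m n k (U : set 'rV[R]_m) (U' : set 'rV[R]_n)
    (f : 'rV[R]_n -> R) (g : 'rV[R]_m -> 'rV[R]_n) :
  open U -> (forall x, U x -> U' (g x)) ->
  (forall j, cdiff k U (fun x => g x 0 j)) -> cdiff k U' f ->
  cdiff k U (f \o g).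
Proof.
move=> oU UU'; elim: k f => [|k IH] f G F.
  split=> // x Ux; apply: differentiable_comp.
    by apply: differentiable_rV => j; exact: (cdiff_differentiable (G j) Ux).
  by apply: (cdiff_differentiable F); exact: UU'.
have dg x : U x -> differentiable g x.
  by move=> Ux; apply: differentiable_rV => j; exact: (cdiff_differentiable (G j) Ux).
have df x : U x -> differentiable f (g x).
  by move=> Ux; apply: cdiff_differentiable F _; exact: UU'.
split=> [x Ux|v]; first by apply: differentiable_comp; [exact: dg | exact: df].
have H j : cdiff k U (fun x => ('D_(basis_vec R j) f \o g) x * 'D_v (fun y => g y 0 j) x).
  apply: cdiffM => //; last exact: cdiff_derive.
  by apply: IH => [i|]; [exact/cdiffW/G | exact: cdiff_derive].
apply: cdiff_eq (cdiff_sum oU H) => // x; rewrite inE => Ux.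
by rewrite derive_comp_rV //; [exact: dg | exact: df].
Qed.

Lemma smooth_on_cdiff (R : realType) m (U : set 'rV[R]_m) f k :
  smooth_on U f -> cdiff k U f.
Proof.
elim: k f => [|k IH] f H; split => //; try exact: (H [::]).
move=> v; apply: IH => vs x Ux.
by have := H (rcons vs v) x Ux; rewrite foldr_rcons.
Qed.

Lemma derive_comm_on (R : realType) m (U : set 'rV[R]_m) f x u v :
  open U -> cdiff 1 U f -> U x -> 'D_v ('D_u f) x = 'D_u ('D_v f) x.
Proof.
move=> oU [H1 H2] Ux; apply: derive_comm.
- by have := open_nbhs_nbhs (conj oU Ux); apply: filterS => y; exact: H1.
- by case: (H2 u) => H _; exact: H.
- by case: (H2 v) => H _; exact: H.
Qed.

(** * The Euclidean product *)

Section Dot.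
Context {R : realType} {m : nat}.
Implicit Types (u v w : 'rV[R]_m) (a : R).

Lemma dotC u v : dot u v = dot v u.
Proof. by apply: eq_bigr => i _; rewrite mulrC. Qed.

Lemma dotDl u v w : dot (u + v) w = dot u w + dot v w.
Proof. by rewrite -big_split /=; apply: eq_bigr => i _; rewrite mxE mulrDl. Qed.

Lemma dotDr u v w : dot w (u + v) = dot w u + dot w v.
Proof. by rewrite ![dot w _]dotC dotDl. Qed.

Lemma dotZl a u v : dot (a *: u) v = a * dot u v.
Proof. by rewrite mulr_sumr; apply: eq_bigr => i _; rewrite mxE mulrA. Qed.

Lemma dotZr a u v : dot u (a *: v) = a * dot u v.
Proof. by rewrite dotC dotZl dotC. Qed.

Lemma dotNl u v : dot (- u) v = - dot u v.
Proof. by rewrite -scaleN1r dotZl mulN1r. Qed.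

Lemma dotNr u v : dot u (- v) = - dot u v.
Proof. by rewrite dotC dotNl dotC. Qed.

Lemma dot0l v : dot 0 v = 0.
Proof. by rewrite /dot big1 // => i _; rewrite mxE mul0r. Qed.

Definition dotE := (dotDl, dotDr, dotNl, dotNr, dotZl, dotZr).

Lemma dot_ge0 u : 0 <= dot u u.
Proof. by apply: sumr_ge0 => i _; rewrite -expr2 sqr_ge0. Qed.

Lemma dot_eq0 u : (dot u u == 0) = (u == 0).
Proof.
apply/eqP/eqP => [|->]; last exact: dot0l.
move=> /eqP; rewrite psumr_eq0; last by move=> i _; rewrite -expr2 sqr_ge0.
move=> /allP H; apply/rowP => i; rewrite mxE.
by apply/eqP; have := H i (mem_index_enum _); rewrite -expr2 sqrf_eq0.
Qed.

Lemma dot_gt0 u : (0 < dot u u) = (u != 0).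
Proof. by rewrite lt_neqAle dot_ge0 andbT eq_sym dot_eq0. Qed.

Lemma dot_basis u i : dot u (basis_vec R i) = u 0 i.
Proof.
rewrite /dot (bigD1 i) //= big1 ?addr0 ?mxE ?eqxx ?mulr1 // => j ji.
by rewrite mxE (negbTE ji) andbF mulr0.
Qed.

Lemma dot_CauchySchwarz u v : dot u v ^+ 2 <= dot u u * dot v v.
Proof.
have [->|v0] := eqVneq v 0; first by rewrite dotC !dot0l expr0n mulr0.
have H := dot_ge0 (dot v v *: u - dot u v *: v).
have E : dot (dot v v *: u - dot u v *: v) (dot v v *: u - dot u v *: v) =
    dot v v * (dot u u * dot v v - dot u v ^+ 2).
  by rewrite !dotE [dot v u]dotC; ring.
move: H; rewrite E.
by rewrite pmulr_rge0 ?dot_gt0 // subr_ge0.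
Qed.

Lemma dot_unit_le1 u v : dot u u = 1 -> dot v v = 1 -> `|dot u v| <= 1.
Proof.
move=> uu vv; have := dot_CauchySchwarz u v; rewrite uu vv mulr1.
by rewrite -real_normK ?num_real // expr_le1.
Qed.

Lemma coord_unit_le1 u i : dot u u = 1 -> `|u 0 i| <= 1.
Proof.
move=> uu; rewrite -dot_basis; apply: dot_unit_le1 => //.
by rewrite dot_basis mxE !eqxx.
Qed.

End Dot.

(** * Maxima along curves *)

Section OneVariableTests.
Context {R : realType}.
Implicit Types (g : R -> R) (t c d : R).

Lemma is_derive_eps g t c : is_derive t (1 : R) g c -> forall e, 0 < e ->
  \forall h \near (0 : R), `|g (h + t) - g t - h * c| <= e * `|h|.
Proof.
move=> dg e e0; have df : differentiable g t by apply/derivable1_diffP.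
apply: filterS (differentiableP_eps df e0) => h.
suff -> : 'd g t h = h * c by [].
have -> : h = h *: (1 : R) by rewrite /GRing.scale /= mulr1.
rewrite linearZ /= -deriveE // (derive_val (is_derive:=dg)).
by rewrite /GRing.scale /= mulr1.
Qed.

Lemma right_derivative_max g c d : is_derive (0 : R) (1 : R) g c -> 0 < d ->
  (forall t, 0 < t < d -> g t <= g 0) -> c <= 0.
Proof.
move=> dg d0 H; apply/ler_addgt0Pl => e e0; rewrite addr0.
have [r /= r0 Hr] := (nbhs_ballP _ _).1 (is_derive_eps dg e0).
pose h := Num.min r d / 2.
have m0 : 0 < Num.min r d by rewrite lt_min r0 d0.
have h0 : 0 < h by rewrite divr_gt0.
have : h < Num.min r d by rewrite /h; lra.
rewrite lt_min => /andP[hr hd].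
have := Hr h; rewrite -ball_normE /= sub0r normrN gtr0_norm // addr0.
move=> /(_ hr); rewrite ler_norml => /andP[H1 _].
have := H h; rewrite h0 hd => /(_ isT) H2.
by rewrite -(ler_pM2l h0); lra.
Qed.

Lemma second_derivative_max g g' c d :
  0 < d -> (forall t, `|t| < d -> is_derive t (1 : R) g (g' t)) ->
  is_derive (0 : R) (1 : R) g' c ->
  (forall t, `|t| < d -> g t <= g 0) -> c <= 0.
Proof.
move=> d0 Hg dg' H.
have g'0 : g' 0 = 0.
  have I t : t \in `]- d, d[ -> `|t| < d by rewrite in_itv /= ltr_norml.
  have Nd : - d < d by lra.
  have D0 : is_derive (0 : R) (1 : R) g 0.
    apply: (@derive1_at_max R g _ _ 0 (ltW Nd)) => [t /I /Hg Ht||t /I]; last exact: H.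
      exact: ex_derive.
    by rewrite in_itv /=; apply/andP; split; lra.
  have D1 := Hg 0; rewrite normr0 in D1; have {}D1 := D1 d0.
  by rewrite -(derive_val (is_derive:=D1)) (derive_val (is_derive:=D0)).
rewrite leNgt; apply/negP => c0.
have c20 : 0 < c / 2 by rewrite divr_gt0.
have [r /= r0 Hr] := (nbhs_ballP _ _).1 (is_derive_eps dg' c20).
pose h := Num.min r d / 2.
have m0 : 0 < Num.min r d by rewrite lt_min r0 d0.
have h0 : 0 < h by rewrite divr_gt0.
have : h < Num.min r d by rewrite /h; lra.
rewrite lt_min => /andP[hr hd].
have small t : t \in `[0, h] -> `|t| < d.
  by rewrite in_itv /= => /andP[t0 th]; rewrite ger0_norm //; lra.
have smallo t : t \in `]0, h[ -> is_derive t (1 : R) g (g' t).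
  by move=> tI; apply/Hg/small; exact: subset_itv_oo_cc.
have [|t tI] := MVT (h0) smallo.
  by apply: derivable_within_continuous => t /small/Hg Ht; exact: ex_derive.
rewrite subr0 in_itv /= in tI *; move: tI => /andP[t0 th] E.
have := Hr t; rewrite -ball_normE /= sub0r normrN gtr0_norm // addr0 g'0 subr0.
move=> /(_ (lt_trans th hr)); rewrite ler_norml => /andP[H1 _].
have g't : 0 < g' t.
  have : 0 < c / 2 * t by rewrite mulr_gt0.
  by lra.
have := H h; rewrite gtr0_norm // => /(_ hd).
by apply/negP; rewrite -ltNge -subr_gt0 E mulr_gt0.
Qed.

End OneVariableTests.

Section CircleTests.
Context {R : realType} {m : nat}.
Local Notation V := 'rV[R]_m.
Implicit Types (f : V -> R) (A B D : V).

(** Great circles ([A = 0]) and latitude circles of the sphere; restricting to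
    them turns maxima over a spherical cap into one-variable maxima. *)
Definition circ A B D (t : R) : V := A + cos t *: B + sin t *: D.

Lemma circ0 A B D : circ A B D 0 = A + B.
Proof. by rewrite /circ cos0 sin0 scale1r scale0r addr0. Qed.

Lemma is_diff_circ A B D t :
  differentiable (circ A B D) t /\
  'D_(1 : R) (circ A B D) t = cos t *: D - sin t *: B.
Proof.
have dc : differentiable (@cos R) t by apply/derivable1_diffP.
have ds : differentiable (@sin R) t by apply/derivable1_diffP.
have H : differentiable (circ A B D) t.
  apply: differentiable_rV => j.
  have -> : (fun y => circ A B D y 0 j) =
      (fun y => A 0 j + B 0 j * cos y + D 0 j * sin y).
    by apply/funext => y; rewrite !mxE mulrC [D 0 j * _]mulrC.
  apply/derivable1_diffP.
  exact: ex_derive.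
split => //; apply/rowP => j; rewrite derive_coord //.
have -> : (fun y => circ A B D y 0 j) =
    (fun y => A 0 j + B 0 j * cos y + D 0 j * sin y).
  by apply/funext => y; rewrite !mxE mulrC [D 0 j * _]mulrC.
rewrite derive_val !mxE /GRing.scale /=; ring.
Qed.

Lemma is_derive_circ f A B D t : differentiable f (circ A B D t) ->
  is_derive t (1 : R) (f \o circ A B D)
    (cos t * 'D_D f (circ A B D t) - sin t * 'D_B f (circ A B D t)).
Proof.
move=> df; have [dc Ec] := is_diff_circ A B D t.
apply: DeriveDef; first exact/derivable1_diffP/(differentiable_comp dc df).
rewrite (derive_chain _ dc df) Ec derive_dirD // -scaleNr !derive_dirZ //.
by rewrite /GRing.scale /= mulNr.
Qed.

Lemma circ_max1 f A B D d : differentiable f (A + B) -> 0 < d ->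
  (forall t, 0 < t < d -> f (circ A B D t) <= f (A + B)) ->
  'D_D f (A + B) <= 0.
Proof.
rewrite -(circ0 A B D) => /is_derive_circ df d0 H.
have := right_derivative_max df d0 H.
by rewrite cos0 sin0 mul1r mul0r subr0.
Qed.

Lemma circ_const f A B D c : differentiable f (A + B) ->
  (forall t, f (circ A B D t) = c) -> 'D_D f (A + B) = 0.
Proof.
rewrite -(circ0 A B D) => /is_derive_circ df H.
have E : f \o circ A B D = cst c by apply/funext => t /=; exact: H.
rewrite E in df; have := derive_val (is_derive:=df).
by rewrite derive_cst cos0 sin0 mul1r mul0r subr0.
Qed.

(** The curve has velocity [D] and acceleration [- B] at time [0], whence the
    first-order correction. *)
Lemma circ_max2 (U : set V) f A B D d : open U -> cdiff 1 U f -> U (A + B) ->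
  0 < d -> (forall t, `|t| < d -> f (circ A B D t) <= f (A + B)) ->
  'D_D ('D_D f) (A + B) - 'D_B f (A + B) <= 0.
Proof.
move=> oU [f1 f2] UAB d0 H.
have Unear : \forall t \near (0 : R), U (circ A B D t).
  have [dc _] := is_diff_circ A B D 0.
  apply: (differentiable_continuous dc); rewrite circ0.
  exact: open_nbhs_nbhs.
have [r /= r0 Hr] := (nbhs_ballP _ _).1 Unear.
have m0 : 0 < Num.min r d by rewrite lt_min r0 d0.
pose g' t := cos t * 'D_D f (circ A B D t) - sin t * 'D_B f (circ A B D t).
have dDD : differentiable ('D_D f) (circ A B D 0).
  by rewrite circ0; case: (f2 D) => h _; exact: h.
have dDB : differentiable ('D_B f) (circ A B D 0).
  by rewrite circ0; case: (f2 B) => h _; exact: h.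
have I1 := is_derive_circ dDD.
have I2 := is_derive_circ dDB.
have Dg' : is_derive (0 : R) (1 : R) g' ('D_D ('D_D f) (A + B) - 'D_B f (A + B)).
  have J := is_deriveB (is_deriveM (is_derive_cos (0 : R)) I1)
    (is_deriveM (is_derive_sin (0 : R)) I2).
  apply: (is_derive_eq J).
  rewrite /comp circ0 sin0 cos0 oppr0.
  move: ('D_D ('D_D f) _) ('D_B ('D_D f) _) ('D_D ('D_B f) _) => a1 a2 a3.
  move: ('D_B ('D_B f) _) ('D_B f _) ('D_D f _) => a4 a5 a6.
  rewrite /GRing.scale /=; ring.
apply: (second_derivative_max m0 _ Dg').
  move=> t; rewrite lt_min => /andP[tr _]; apply: is_derive_circ.
  by apply: f1; apply: Hr; rewrite -ball_normE /= sub0r normrN.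
by move=> t; rewrite lt_min => /andP[_ td]; rewrite /= circ0; exact: H.
Qed.

End CircleTests.

(** * Perturbation of eigenvalues *)

Section UltrafilterLimits.
Context {R : realType} {T : Type} (G : set_system T) {GU : UltraFilter G}.

(** Along an ultrafilter all bounded quantities converge at once, which replaces
    the repeated extraction of subsequences. *)
Lemma ultra_bounded_cvg (q : T -> R) (b : R) :
  (\forall t \near G, `|q t| <= b) -> cvg (q @ G).
Proof.
move=> qb.
have Gq : (q @ G) `[- b, b]%classic.
  by apply: filterS qb => t /=; rewrite ler_norml in_itv.
have [p [_ clp]] := @segment_compact _ (- b) b _ _ Gq.
apply/cvg_ex; exists p => B pB.
have [//|GC] := in_ultra_setVsetC (q @^-1` B) GU.
have [x [/= nBx Bx]] : (~` B) `&` B !=set0 by exact: clp GC pB.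
by [].
Qed.

Lemma cvg_sumr n (f : 'I_n -> T -> R) (a : 'I_n -> R) :
  (forall i, f i @ G --> a i) ->
  (fun t => \sum_(i < n) f i t) @ G --> \sum_(i < n) a i.
Proof.
move=> H; elim: (index_enum _) => [|i r IH].
  rewrite big_nil; under eq_fun do rewrite big_nil.
  exact: cvg_cst.
rewrite big_cons; under eq_fun do rewrite big_cons.
exact: cvgD.
Qed.

Lemma cvg_rV n (u : T -> 'rV[R]_n) (u0 : 'rV[R]_n) :
  (forall i, (fun t => u t 0 i) @ G --> u0 0 i) -> u @ G --> u0.
Proof.
move=> H; apply/cvgrPdist_le => e e0; near=> t.
rewrite /Num.norm /= mx_normrE (bigmax_le _ (ltW e0)) //= => -[k i] _ /=.
rewrite !mxE (ord1 k) {k}; move: i; near: t.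
apply: filter_forall => i.
by have /cvgrPdist_le := H i; exact.
Unshelve. all: by end_near. Qed.

Lemma cvg_dot n (u v : T -> 'rV[R]_n) (u0 v0 : 'rV[R]_n) :
  (forall i, (fun t => u t 0 i) @ G --> u0 0 i) ->
  (forall i, (fun t => v t 0 i) @ G --> v0 0 i) ->
  (fun t => dot (u t) (v t)) @ G --> dot u0 v0.
Proof. by move=> Hu Hv; apply: cvg_sumr => i; exact: cvgM. Qed.

Lemma cvg_mulmx n k (u : T -> 'rV[R]_n) (A : T -> 'M[R]_(n, k))
    (u0 : 'rV[R]_n) (A0 : 'M[R]_(n, k)) :
  (forall i, (fun t => u t 0 i) @ G --> u0 0 i) ->
  (forall i j, (fun t => A t i j) @ G --> A0 i j) ->
  forall j, (fun t => (u t *m A t) 0 j) @ G --> (u0 *m A0) 0 j.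
Proof.
move=> Hu HA j; rewrite mxE.
under eq_fun do rewrite mxE.
by apply: cvg_sumr => i; exact: cvgM.
Qed.

Lemma cvg_near_eq (q q' : T -> R) (a : R) :
  q @ G --> a -> (\forall t \near G, q' t = q t) -> q' @ G --> a.
Proof.
by move=> qa E; apply: cvg_trans qa; apply: near_eq_cvg; apply: filterS E => t ->.
Qed.

Lemma cvg_near_unique (q q' : T -> R) (a b : R) :
  q @ G --> a -> q' @ G --> b -> (\forall t \near G, q' t = q t) -> a = b.
Proof.
move=> qa q'b E; have q'a := cvg_near_eq qa E.
by rewrite -(cvg_lim _ q'a) // -(cvg_lim _ q'b).
Qed.

End UltrafilterLimits.

Lemma dot_mulmx_sym (R : realType) m (A : 'M[R]_m) (u v : 'rV[R]_m) :
  A^T = A -> dot (u *m A) v = dot u (v *m A).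
Proof.
move=> sA.
have E (a b : 'rV[R]_m) : dot a b = (a *m b^T) 0 0.
  by rewrite mxE; apply: eq_bigr => i _; rewrite mxE.
by rewrite !E trmx_mul sA mulmxA.
Qed.

(** Multiple eigenvalues of a symmetric matrix need not depend differentiably on
    it.  But along an ultrafilter converging to [0] the eigenframes [E t]
    converge to an eigenframe [E0], and pairing [E t i *m A t] with [E0 i] in two
    ways gives
      [(l t i - l0 i) * <E t i, E0 i> = <E t i, E0 i *m (A t - A 0)>],
    so that the difference quotients of the eigenvalues converge to the diagonal
    of [A'] in the frame [E0].  This differentiates every differentiable function
    of the eigenvalues.  The vectors [y t] carry a linear constraint on the
    frames to the limit. *)
Lemma eigenvalues_perturbation (R : realType) m n (A : R -> 'M[R]_m)
    (A' : 'M[R]_m) (E : R -> 'I_n -> 'rV[R]_m) (l : R -> 'rV[R]_n)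
    (y : R -> 'rV[R]_m) :
  (forall i j, is_derive (0 : R) (1 : R) (fun t => A t i j) (A' i j)) ->
  (forall i, {for 0, continuous (fun t => y t 0 i)}) ->
  (A 0)^T = A 0 ->
  (\forall t \near 0^', (A t)^T = A t /\ forall i,
     [/\ E t i *m A t = l t 0 i *: E t i, dot (E t i) (y t) = 0
       & forall j, dot (E t i) (E t j) = (i == j)%:R]) ->
  exists E0 : 'I_n -> 'rV[R]_m, exists l0 d : 'rV[R]_n,
    [/\ forall i, [/\ E0 i *m A 0 = l0 0 i *: E0 i, dot (E0 i) (y 0) = 0
                    & forall j, dot (E0 i) (E0 j) = (i == j)%:R],
        forall i, d 0 i = dot (E0 i *m A') (E0 i)
      & forall (F : 'rV[R]_n -> R) (f : R -> R) (c : R),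
          differentiable F l0 -> is_derive (0 : R) (1 : R) f c ->
          (\forall t \near 0^', F (l t) = f t) ->
          F l0 = f 0 /\ 'D_d F l0 = c].
Proof.
move=> dA cy sA0 nearE.
have [G [GU sG]] := ultraFilterLemma (Proper_dnbhs_numFieldType (0 : R)).
have GP : ProperFilter G by exact: ultra_proper.
have GE := sG _ nearE.
have cvgG (f : R -> R) : {for 0, continuous f} -> f @ G --> f 0.
  by move=> cf B /cf; rewrite /= => nB; apply: sG; exact: nbhs_dnbhs nB.
have quotG (f : R -> R) c : is_derive (0 : R) (1 : R) f c ->
    (fun t => t^-1 * (f t - f 0)) @ G --> c.
  move=> df B cB; apply: sG.
  have [/cvg_ex[/= l1 Hl] Dl] := df.
  have El : l1 = c by rewrite -Dl; apply/esym/cvg_lim.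
  have Eq : (fun h : R => h^-1 *: (f (h *: (1 : R) + 0) - f 0)) =
      (fun t => t^-1 * (f t - f 0)).
    by apply/funext => t; rewrite addr0 /GRing.scale /= mulr1.
  by rewrite -El in cB; move: Hl; rewrite Eq => /(_ _ cB).
have cA i j : (fun t => A t i j) @ G --> A 0 i j.
  apply: (cvgG (fun t => A t i j)); apply: differentiable_continuous.
  by apply/derivable1_diffP; have := dA i j => -[].
have cyG i : (fun t => y t 0 i) @ G --> y 0 0 i by exact: (cvgG (fun t => y t 0 i)).
pose E0 i : 'rV[R]_m := \row_j lim ((fun t => E t i 0 j) @ G).
have cE i j : (fun t => E t i 0 j) @ G --> E0 i 0 j.
  rewrite mxE; apply: (ultra_bounded_cvg (b := 1)).
  apply: filterS GE => t [_ /(_ i)[_ _ /(_ i)]]; rewrite eqxx.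
  exact: coord_unit_le1.
have G0 : \forall t \near G, t != 0.
  by apply: sG; exists 1 => //= t _ t0.
pose l0 : 'rV[R]_n := \row_i dot (E0 i *m A 0) (E0 i).
pose d : 'rV[R]_n := \row_i dot (E0 i *m A') (E0 i).
have orth0 i j : dot (E0 i) (E0 j) = (i == j)%:R.
  apply: (@cvg_near_unique _ _ _ _ (fun t => dot (E t i) (E t j))
    (fun=> (i == j)%:R)); [exact: cvg_dot | exact: cvg_cst |].
  by apply: filterS GE => t [_ /(_ i)[_ _ /(_ j)]] ->.
have cl i : (fun t => l t 0 i) @ G --> l0 0 i.
  rewrite mxE.
  apply: (@cvg_near_eq _ _ _ _ (fun t => dot (E t i *m A t) (E t i))).
    by apply: cvg_dot => //; exact: cvg_mulmx.
  apply: filterS GE => t [_ /(_ i)[-> _ /(_ i)]].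
  by rewrite eqxx dotZl => ->; rewrite mulr1.
have eig0 i : E0 i *m A 0 = l0 0 i *: E0 i.
  apply/rowP => j.
  rewrite [RHS]mxE; apply: (@cvg_near_unique _ _ _ _ (fun t => (E t i *m A t) 0 j)
    (fun t => l t 0 i * E t i 0 j)); [exact: (cvg_mulmx (cE i) cA) | exact: cvgM |].
  by apply: filterS GE => t [_ /(_ i)[-> _ _]]; rewrite mxE.
pose Q (t : R) : 'M[R]_m := t^-1 *: (A t - A 0).
have cQ i j : (fun t => Q t i j) @ G --> A' i j.
  by under eq_fun do rewrite !mxE; exact: quotG.
(* The pairing identity, divided by [t]. *)
have cq i : (fun t => t^-1 * (l t 0 i - l0 0 i)) @ G --> d 0 i.
  have -> : d 0 i = dot (E0 i *m A') (E0 i) by rewrite mxE.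
  have c1 : (fun t => dot (E t i) (E0 i)) @ G --> (1 : R).
    have <- : dot (E0 i) (E0 i) = 1 by rewrite orth0 eqxx.
    by apply: cvg_dot => // j; exact: cvg_cst.
  have c2 : (fun t => dot (E0 i *m Q t) (E t i)) @ G --> dot (E0 i *m A') (E0 i).
    by apply: cvg_dot => //; apply: cvg_mulmx => // j; exact: cvg_cst.
  have c3 : (fun t => dot (E0 i *m Q t) (E t i) * (dot (E t i) (E0 i))^-1) @ G
      --> dot (E0 i *m A') (E0 i).
    rewrite -[X in _ --> X]mulr1 -invr1; apply: cvgM => //.
    by apply: cvgV => //; exact: oner_neq0.
  apply: (cvg_near_eq c3).
  have Gn0 : \forall t \near G, dot (E t i) (E0 i) != 0.
    have /cvgrPdist_lt /(_ _ ltr01) := c1; apply: filterS => t.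
    by apply: contraTneq => ->; rewrite subr0 normr1 ltxx.
  near=> t => /=.
  have n0 : dot (E t i) (E0 i) != 0 by near: t.
  have [sA /(_ i)[Et _ _]] : ((A t)^T = A t /\ forall i,
     [/\ E t i *m A t = l t 0 i *: E t i, dot (E t i) (y t) = 0
       & forall j, dot (E t i) (E t j) = (i == j)%:R]) by near: t.
  apply: (mulIf n0); rewrite mulfVK // /Q -scalemxAr dotZl -mulrA; congr (_ * _).
  rewrite mulmxBr dotDl dotNl eig0 dot_mulmx_sym // Et !dotE.
  by rewrite [dot (E0 i) _]dotC mulrBl.
exists E0, l0, d; split.
- move=> i; split => //.
  apply: (@cvg_near_unique _ _ _ _ (fun t => dot (E t i) (y t))
    (fun=> 0)); [exact: cvg_dot | exact: cvg_cst |].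
  by apply: filterS GE => t [_ /(_ i)[_ -> _]].
- by move=> i; rewrite mxE.
move=> F f c dF df Ff.
have GFf := sG _ Ff.
have F0 : F l0 = f 0.
  have cf : {for 0, continuous f}.
    by apply: differentiable_continuous; apply/derivable1_diffP; case: df.
  have cF := differentiable_continuous dF.
  apply: (@cvg_near_unique _ _ _ _ (F \o l) f _ _ _ (cvgG f cf)).
    exact: (cvg_comp _ _ (cvg_rV cl) cF).
  by apply: filterS GFf => t /= ->.
split => //.
pose q t : 'rV[R]_n := t^-1 *: (l t - l0).
have cqv : q @ G --> d.
  apply: cvg_rV => i; apply: (cvg_near_eq (cq i)).
  by apply: filterE => t; rewrite /q [LHS]mxE [X in _ * X = _]mxE [X in _ * (_ + X) = _]mxE.
have cdq : (fun t => 'd F l0 (q t)) @ G --> 'd F l0 d.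
  by apply: (cvg_comp _ _ cqv); exact: (diff_continuous dF).
rewrite deriveE //; apply/eqP; rewrite -subr_eq0 -normr_le0.
apply/ler_addgt0Pl => e e0; rewrite addr0.
pose b := `|d| + 1.
have b0 : 0 < b by rewrite ltr_wpDl.
pose e1 := e / (b + 2).
have e10 : 0 < e1 by rewrite divr_gt0 // addr_gt0.
have Ge : \forall t \near G,
    `|F ((l t - l0) + l0) - F l0 - 'd F l0 (l t - l0)| <= e1 * `|l t - l0|.
  have c0 : (fun t => l t - l0) @ G --> (0 : 'rV[R]_n).
    by rewrite -(subrr l0); apply: cvgB; [exact: cvg_rV | exact: cvg_cst].
  exact: (c0 _ (differentiableP_eps dF e10)).
have Gq : \forall t \near G, `|q t| <= b.
  have /cvgrPdist_le /(_ _ ltr01) := cqv; apply: filterS => t H.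
  have -> : q t = d - (d - q t) by rewrite opprB addrC subrK.
  by apply: (le_trans (ler_normB _ _)); rewrite lerD2l.
have /cvgrPdist_le /(_ _ e10) Gd := cdq.
have /cvgrPdist_le /(_ _ e10) Gf := quotG f c df.
have [t [[H1 H2] [[H3 H4] [H5 H6]]]] : exists t : R,
  (`|F ((l t - l0) + l0) - F l0 - 'd F l0 (l t - l0)| <= e1 * `|l t - l0| /\
   `|q t| <= b) /\
  ((`|'d F l0 d - 'd F l0 (q t)| <= e1 /\ `|c - t^-1 * (f t - f 0)| <= e1) /\
   (t != 0 /\ F (l t) = f t)).
  by apply: (@filter_ex _ G); near=> t; do !split; near: t.
have Elq : l t - l0 = t *: q t by rewrite /q scalerA mulfV // scale1r.
move: H1; rewrite subrK Elq linearZ /= normrZ H6 F0 => H1.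
have t0 : 0 < `|t| by rewrite normr_gt0.
have H7 : `|t^-1 * (f t - f 0) - 'd F l0 (q t)| <= e1 * b.
  rewrite -(ler_pM2l t0) -normrM mulrBr mulrA mulfV // mul1r.
  apply: (le_trans H1); rewrite mulrCA ler_pM2l //.
  by rewrite ler_pM2l.
apply: (le_trans (ler_distD ('d F l0 (q t)) _ _)).
apply: (le_trans (lerD H3 (ler_distD (t^-1 * (f t - f 0)) _ _))).
rewrite distrC in H7; rewrite distrC in H4.
apply: (le_trans (lerD (lexx _) (lerD H7 H4))).
rewrite le_eqVlt; apply/orP; left; apply/eqP; rewrite /e1; field.
by rewrite gt_eqF // addr_gt0.
Unshelve. all: by end_near. Qed.

(** * The homogeneous extension *)

Section Radial.
Context {R : realType} {m : nat}.
Local Notation V := 'rV[R]_m.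
Implicit Types (x v : V).

Definition punctured : set V := [set x | 0 < dot x x].
Definition nrm x : R := dot x x `^ 2^-1.
Definition direction x : V := (nrm x)^-1 *: x.

Lemma cdiff_dot k (U : set V) : open U -> cdiff k U (fun x => dot x x).
Proof. by move=> oU; apply: cdiff_sum => // i; apply: cdiffM => //; exact: cdiff_coord. Qed.

Lemma dot_continuous : continuous (fun x : V => dot x x).
Proof.
move=> x; apply: differentiable_continuous.
exact: (cdiff_differentiable (cdiff_dot 0 openT)).
Qed.

Lemma open_punctured : open punctured.
Proof.
have -> : punctured = (fun x : V => dot x x) @^-1` [set r | 0 < r] by [].
by apply: open_comp => [x _|]; [exact: dot_continuous | exact: open_gt].
Qed.

Lemma nrm_gt0 x : punctured x -> 0 < nrm x.
Proof. exact: powR_gt0. Qed.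

Lemma nrm_sq x : nrm x ^+ 2 = dot x x.
Proof.
rewrite -powR_mulrn ?powR_ge0 // /nrm -powRrM mulVf ?powRr1 ?dot_ge0 //.
Qed.

Lemma nrm_direction x : punctured x -> nrm x *: direction x = x.
Proof. by move=> /nrm_gt0 x0; rewrite scalerA mulfV ?scale1r // gt_eqF. Qed.

Lemma dot_direction x : punctured x -> dot (direction x) (direction x) = 1.
Proof.
move=> /nrm_gt0 x0; rewrite /direction !dotE -nrm_sq; field.
by rewrite gt_eqF.
Qed.

Lemma dot_direction_r x v : punctured x -> nrm x * dot v (direction x) = dot v x.
Proof. by move=> Px; rewrite -dotZr nrm_direction. Qed.

Lemma nrm_unit x : dot x x = 1 -> nrm x = 1.
Proof. by rewrite /nrm => ->; rewrite powR1. Qed.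

Lemma direction_unit x : dot x x = 1 -> direction x = x.
Proof. by move=> /nrm_unit; rewrite /direction => ->; rewrite invr1 scale1r. Qed.

Lemma cdiff_nrm k : cdiff k punctured nrm.
Proof.
apply: cdiff_powR => //; [exact: open_punctured|].
exact/cdiff_dot/open_punctured.
Qed.

Lemma cdiff_direction k j : cdiff k punctured (fun x => direction x 0 j).
Proof.
have H := cdiff_powR (-1) open_punctured (fun x => @nrm_gt0 x) (cdiff_nrm k).
apply: cdiff_eq (cdiffM open_punctured H (cdiff_coord _ _ j)).
  exact: open_punctured.
by move=> x; rewrite inE => /nrm_gt0 x0; rewrite mxE powR_inv1 // ltW.
Qed.

Lemma derive_nrm x v : punctured x -> 'D_v nrm x = dot v (direction x).
Proof.
move=> Px; have x0 := nrm_gt0 Px.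
have dd := cdiff_differentiable (cdiff_dot 0 open_punctured) Px.
have E : 'D_v (fun y => nrm y ^+ 2) x = 2 * dot v x.
  have -> : (fun y => nrm y ^+ 2) = \sum_(i < m) (fun y : V => y 0 i * y 0 i).
    by apply/funext => y; rewrite nrm_sq fct_sumE.
  rewrite derive_sum => [|i]; last first.
    by apply: derivableM; apply: diff_derivable; exact: differentiable_coord.
  rewrite mulr_sumr; apply: eq_bigr => i _.
  have dc : derivable (fun y : V => y 0 i : R) x v.
    by apply: diff_derivable; exact: differentiable_coord.
  rewrite (deriveM dc dc) derive_coordE /GRing.scale /=; ring.
have dn : derivable nrm x v.
  by apply: diff_derivable; exact: (cdiff_differentiable (cdiff_nrm 0) Px).
move: E; rewrite -[X in 'D_v X x]/(nrm ^+ 2) deriveX // -(dot_direction_r v Px).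
rewrite /GRing.scale /= expr1 => E.
have n20 : 2 * nrm x != 0 by rewrite mulf_neq0 // gt_eqF.
by apply: (mulfI n20); rewrite E mulrA.
Qed.

Lemma derive_direction x v : punctured x ->
  'D_v direction x = (nrm x)^-1 *: (v - dot v (direction x) *: direction x).
Proof.
move=> Px; have x0 := nrm_gt0 Px.
have n0 : nrm x != 0 by rewrite gt_eqF.
have dd j := cdiff_differentiable (cdiff_direction 0 j) Px.
have dD : differentiable direction x by exact: differentiable_rV.
have dn := cdiff_differentiable (cdiff_nrm 0) Px.
apply/rowP => j; rewrite derive_coord //.
have E : 'D_v (fun y => nrm y * direction y 0 j) x = v 0 j.
  rewrite -(derive_coordE x v j); apply: near_eq_derive.
  apply: (near_open open_punctured _ Px) => y; rewrite inE => Py.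
  by rewrite -[in RHS](nrm_direction Py) [in RHS]mxE.
move: E; rewrite -[X in 'D_v X x]/(nrm * (fun y => direction y 0 j)).
rewrite deriveM; [|exact: diff_derivable|exact: diff_derivable].
rewrite derive_nrm // /GRing.scale /= => E.
apply: (mulfI n0); rewrite !mxE mulrA mulfV // mul1r -E mxE.
by ring.
Qed.

End Radial.

(** A derivative of a function of degree [a] has degree [a - 1]: Euler's relation
    is differentiated in the direction [v], and mixed derivatives are exchanged. *)
Lemma euler_derive (R : realType) m (U : set 'rV[R]_m) (g : 'rV[R]_m -> R) a v x :
  open U -> cdiff 1 U g -> (forall y, U y -> 'D_y g y = a * g y) -> U x ->
  'D_x ('D_v g) x = (a - 1) * 'D_v g x.
Proof.
move=> oU cg Eg Ux.
have dg y : U y -> differentiable g y := cdiff_differentiable cg.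
have ddg u : differentiable ('D_u g) x.
  exact: (cdiff_differentiable (cdiff_derive u cg) Ux).
have E : 'D_v (fun y => dot y (grad g y)) x = a * 'D_v g x.
  rewrite -[RHS]/(a *: _) -deriveZ; last exact/diff_derivable/dg.
  apply: near_eq_derive; apply: (near_open oU _ Ux) => y; rewrite inE => Uy.
  by rewrite -derive_dot ?Eg //; exact: dg.
have E2 : 'D_v (fun y => dot y (grad g y)) x = 'D_v g x + 'D_x ('D_v g) x.
  have -> : (fun y => dot y (grad g y)) = \sum_(i < m) ((fun y : 'rV[R]_m => y 0 i) *
      (fun y => 'D_(basis_vec R i) g y)).
    by apply/funext => y; rewrite fct_sumE; apply: eq_bigr => i _; rewrite mxE.
  have dc i : derivable (fun y : 'rV[R]_m => y 0 i : R) x v.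
    by apply: diff_derivable; exact: differentiable_coord.
  rewrite derive_sum => [|i]; last by apply: derivableM => //; exact/diff_derivable.
  rewrite (derive_dot v (dg _ Ux)) (derive_dot x (ddg v)) /dot -big_split; apply: eq_bigr => i _ /=.
  rewrite deriveM //; last exact/diff_derivable.
  rewrite derive_coordE !mxE (derive_comm_on _ _ oU cg Ux) /GRing.scale /=.
  by ring.
by move: E; rewrite E2 => E; rewrite mulrBl mul1r -E; ring.
Qed.

Lemma dot_hess_row (R : realType) m (U : set 'rV[R]_m) (f : 'rV[R]_m -> R) x u v :
  open U -> cdiff 1 U f -> U x ->
  dot v (\row_j 'D_u ('D_(basis_vec R j) f) x) = 'D_u ('D_v f) x.
Proof.
move=> oU cf Ux; have comm w := derive_comm_on w u oU cf Ux.
have d1 : differentiable ('D_u f) x.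
  exact: (cdiff_differentiable (cdiff_derive u cf) Ux).
apply/esym; rewrite [LHS](comm v) [LHS](derive_dot v d1).
have -> // : grad ('D_u f) x = \row_j 'D_u ('D_(basis_vec R j) f) x.
by apply/rowP => j; rewrite [LHS]mxE [RHS]mxE; exact/esym/comm.
Qed.

Section HomogeneousExtension.
Context {R : realType} {n : nat} (theta : R) (U : set 'rV[R]_n.+1)
  (s : 'rV[R]_n.+1 -> R).
Hypotheses (oU : open U) (sU : smooth_on U s).
Local Notation V := 'rV[R]_n.+1.
Local Notation ce := (cos theta *: e_last R n).
Implicit Types (x v : V).

Definition cap_point x : V := direction x - ce.
(** The extension of [s] that is homogeneous of degree one in the unit normal [x]
    of the cap: the support function in the usual Euclidean sense. *)
Definition support_fun x : R := nrm x * s (cap_point x).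
Definition support_cone : set V := [set x | punctured x /\ U (cap_point x)].

Lemma normal_cap_point x : normal theta (cap_point x) = direction x.
Proof. by rewrite /normal subrK. Qed.

Lemma cdiff_cap_point k j : cdiff k punctured (fun x => cap_point x 0 j).
Proof.
have H := cdiffD open_punctured (cdiff_direction k j)
  (cdiff_cst k punctured (- (ce : V) 0 j)).
by apply: cdiff_eq H => [|x _]; [exact: open_punctured | rewrite !mxE].
Qed.

Lemma differentiable_cap_point x : punctured x -> differentiable cap_point x.
Proof.
move=> Px; apply: differentiable_rV => j.
exact: (cdiff_differentiable (cdiff_cap_point 0 j) Px).
Qed.

Lemma open_cone : open support_cone.
Proof.
rewrite openE => x [Px Ux]; apply: filterI.
  exact: open_nbhs_nbhs (conj open_punctured Px).
have := differentiable_continuous (differentiable_cap_point Px).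
by apply; exact: open_nbhs_nbhs (conj oU Ux).
Qed.

Lemma cdiff_support k : cdiff k support_cone support_fun.
Proof.
have sub : support_cone `<=` punctured by move=> x [].
apply: cdiffM; [exact: open_cone | exact: cdiffS sub (cdiff_nrm k) |].
apply: (@cdiff_comp _ _ _ _ _ U _ cap_point); first exact: open_cone.
- by move=> x [].
- by move=> j; exact: cdiffS sub (cdiff_cap_point k j).
- exact: smooth_on_cdiff.
Qed.

Lemma derive_cap_point x v : punctured x ->
  'D_v cap_point x = (nrm x)^-1 *: (v - dot v (direction x) *: direction x).
Proof.
move=> Px; rewrite -[RHS]derive_direction //.
rewrite -[cap_point]/(direction - cst (ce : V)) deriveB.
- by rewrite derive_cst subr0.
- apply: diff_derivable; apply: differentiable_rV => j.
  exact: (cdiff_differentiable (cdiff_direction 0 j) Px).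
- exact: derivable_cst.
Qed.

Lemma derive_support x v : support_cone x ->
  'D_v support_fun x =
    dot v (nabla theta s (cap_point x)) + s (cap_point x) * dot v (direction x).
Proof.
move=> [Px Ux]; have n0 : nrm x != 0 by rewrite gt_eqF // nrm_gt0.
have ds : differentiable s (cap_point x) := sU [::] Ux.
have dp := differentiable_cap_point Px.
have dn := cdiff_differentiable (cdiff_nrm 0) Px.
have dsp : differentiable (s \o cap_point) x by exact: differentiable_comp.
rewrite -[support_fun]/(nrm * (s \o cap_point)) deriveM; try exact: diff_derivable.
rewrite derive_nrm // (derive_chain _ dp ds) derive_cap_point // (derive_dirZ _ _ ds).
rewrite (derive_dot _ ds) /nabla /tangent_proj normal_cap_point /GRing.scale /=.
rewrite mulrA mulfV // mul1r !dotE [dot x _]dotC.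
by ring.
Qed.

Lemma grad_support x : support_cone x ->
  grad support_fun x = nabla theta s (cap_point x) + s (cap_point x) *: direction x.
Proof.
move=> Cx; apply/rowP => j; rewrite mxE derive_support //.
by rewrite ![dot (basis_vec _ _) _]dotC !dot_basis !mxE.
Qed.

Lemma dot_nabla_normal x : punctured x ->
  dot (nabla theta s (cap_point x)) (direction x) = 0.
Proof.
move=> Px; rewrite /nabla /tangent_proj normal_cap_point dotDl dotNl dotZl dot_direction //.
by rewrite mulr1 subrr.
Qed.

Lemma support_euler x : support_cone x -> 'D_x support_fun x = 1 * support_fun x.
Proof.
move=> /[dup] Cx [Px _]; rewrite derive_support // mul1r /support_fun.
have E w : dot x w = nrm x * dot (direction x) w by rewrite -dotZl nrm_direction.
rewrite !E [dot _ (nabla _ _ _)]dotC dot_nabla_normal // dot_direction //.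
by rewrite mulr0 add0r mulr1 mulrC.
Qed.

Lemma hess_support_radial x v : support_cone x -> 'D_x ('D_v support_fun) x = 0.
Proof.
move=> Cx; rewrite (euler_derive (a := 1) _ open_cone (cdiff_support 1)) //.
  by rewrite subrr mul0r.
by move=> y; exact: support_euler.
Qed.

Lemma third_support_radial x u v : support_cone x ->
  'D_x ('D_u ('D_v support_fun)) x = - 'D_u ('D_v support_fun) x.
Proof.
move=> Cx; rewrite (euler_derive (a := 0) _ open_cone) //.
- by rewrite sub0r mulN1r.
- exact/cdiff_derive/(cdiff_support 2).
- by move=> y Cy; rewrite mul0r hess_support_radial.
Qed.

(** Covariant second derivatives are flat second derivatives of the extension.
    Differentiating [grad S = nabla s + s x] gives
    [D_X (nabla s) + (D_X s) x + s X]; its normal component vanishes because [S]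
    has degree one, so it agrees with its own tangential projection. *)
Lemma tau_sharp_support x X : support_cone x -> dot x x = 1 -> dot X x = 0 ->
  tau_sharp theta s (cap_point x) X = \row_j 'D_X ('D_(basis_vec R j) support_fun) x.
Proof.
move=> Cx xx Xx; have [Px Ux] := Cx.
have dx := direction_unit xx.
have dcp := differentiable_cap_point Px.
have Dcp : 'D_X cap_point x = X.
  by rewrite derive_cap_point // dx nrm_unit // Xx scale0r subr0 invr1 scale1r.
have cs := smooth_on_cdiff 1 sU.
have ds : differentiable s (cap_point x) := sU [::] Ux.
have dgrad j : differentiable (fun y => grad s y 0 j) (cap_point x).
  have H := cdiff_differentiable (cdiff_derive (basis_vec R j) cs) Ux.
  have -> // : (fun y => grad s y 0 j) = 'D_(basis_vec R j) s.
  by apply/funext => y; rewrite mxE.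
have dnorm j : differentiable (fun y => normal theta y 0 j) (cap_point x).
  have -> : (fun y => normal theta y 0 j) =
      (fun y : V => y 0 j) + cst ((ce : V) 0 j).
    by apply/funext => y; rewrite !mxE.
  by apply: differentiableD; [exact: differentiable_coord | exact: differentiable_cst].
have dnab : differentiable (nabla theta s) (cap_point x).
  apply: differentiable_rV => j.
  have -> : (fun y => nabla theta s y 0 j) = (fun y => grad s y 0 j) -
      (\sum_i (fun y => grad s y 0 i) * (fun y => normal theta y 0 i)) *
      (fun y => normal theta y 0 j).
    apply/funext => y; rewrite /nabla /tangent_proj.
    rewrite [LHS]mxE [X in _ + X = _]mxE [X in _ - X = _]mxE.
    by congr (_ - _ * _); rewrite fct_sumE.
  apply: differentiableB => //; apply: differentiableM => //.
  by apply: differentiable_sum => i; apply: differentiableM.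
have E j : 'D_X ('D_(basis_vec R j) support_fun) x =
    ('D_X (nabla theta s) (cap_point x)) 0 j +
    ('D_X s (cap_point x) * x 0 j + s (cap_point x) * X 0 j).
  pose gj y := (fun z => nabla theta s z 0 j) (cap_point y) +
    s (cap_point y) * direction y 0 j.
  have -> : 'D_X ('D_(basis_vec R j) support_fun) x = 'D_X gj x.
    apply: near_eq_derive; apply: (near_open open_cone _ Cx) => y; rewrite inE => Cy.
    by rewrite derive_support // ![dot (basis_vec _ _) _]dotC !dot_basis.
  have dnj : differentiable (fun z => nabla theta s z 0 j) (cap_point x).
    exact: (differentiable_comp dnab (differentiable_coord _ _ _)).
  have d1 := differentiable_comp dcp dnj.
  have d2 := differentiable_comp dcp ds.
  have d3 := cdiff_differentiable (cdiff_direction 0 j) Px.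
  have -> : gj = ((fun z => nabla theta s z 0 j) \o cap_point) +
    (s \o cap_point) * (fun y => direction y 0 j) by [].
  rewrite deriveD; [|exact: diff_derivable
    |apply: derivableM; exact: diff_derivable].
  rewrite deriveM; try exact: diff_derivable.
  rewrite (derive_chain _ dcp dnj) (derive_chain _ dcp ds) Dcp derive_coord //.
  have dD : differentiable direction x.
    by apply: differentiable_rV => i; exact: (cdiff_differentiable (cdiff_direction 0 i) Px).
  rewrite -(derive_coord _ _ dD) derive_direction // dx nrm_unit // Xx.
  rewrite scale0r subr0 invr1 scale1r /GRing.scale /=; ring.
set H := \row_j _.
have EH : H = 'D_X (nabla theta s) (cap_point x) +
    ('D_X s (cap_point x) *: x + s (cap_point x) *: X).
  by apply/rowP => j; rewrite [LHS]mxE E [RHS]mxE; congr (_ + _); rewrite [RHS]mxE; congr (_ + _); rewrite [RHS]mxE.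
have Hx : dot H x = 0.
  by rewrite dotC (dot_hess_row _ _ open_cone (cdiff_support 1) Cx) (derive_comm_on _ _ open_cone (cdiff_support 1) Cx)
    hess_support_radial.
rewrite /tau_sharp /covariant /tangent_proj normal_cap_point dx.
move: Hx; rewrite EH !dotE Xx xx mulr0 addr0 mulr1 => /eqP.
rewrite addr_eq0 => /eqP ->.
by rewrite scaleNr opprK addrA.
Qed.

End HomogeneousExtension.

(** * Geometry of the spherical cap *)

Section CapGeometry.
Context {R : realType} {n : nat} (theta : R).
Hypotheses (theta_gt0 : 0 < theta) (theta_lt : theta < pi / 2).
Local Notation V := 'rV[R]_n.+1.
Local Notation e := (e_last R n).
Local Notation K := (@sphere_cap R n theta).
Implicit Types (x v : V).

Lemma theta_lt_pi : theta < pi.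
Proof.
apply: (lt_trans theta_lt).
by rewrite ltr_pdivrMr // ltr_pMr ?pi_gt0 // ltr1n.
Qed.

Lemma cos_theta_gt0 : 0 < cos theta.
Proof.
apply: cos_gt0_pihalf; rewrite theta_lt andbT (lt_trans _ theta_gt0) //.
by rewrite oppr_lt0 divr_gt0 // pi_gt0.
Qed.

Lemma sin_theta_gt0 : 0 < sin theta.
Proof. by apply: sin_gt0_pi; rewrite theta_gt0 theta_lt_pi. Qed.

Lemma dot_e_last : dot e e = 1.
Proof. by rewrite dot_basis mxE !eqxx. Qed.

Lemma sphere_cap_nonempty : K !=set0.
Proof. by exists e; rewrite /sphere_cap /= dot_e_last; split => //; exact: cos_le1. Qed.

Lemma continuous_dot_r v : continuous (fun x : V => dot x v).
Proof.
move=> x; apply: differentiable_continuous.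
have H : cdiff 0 setT (fun x : V => dot x v).
  by apply: cdiff_sum => [|i]; [exact: openT | apply: cdiffM;
    [exact: openT | exact: cdiff_coord | exact: cdiff_cst]].
exact: (cdiff_differentiable H).
Qed.

Lemma sphere_cap_compact : compact K.
Proof.
apply: bounded_closed_compact.
  exists 1; split => // M M1 x [xx _].
  rewrite /Num.norm /= mx_normrE; apply: bigmax_le => [|[i j] _ /=].
    by rewrite ltW // (lt_trans _ M1).
  by rewrite (ord1 i) (le_trans _ (ltW M1)) // coord_unit_le1.
have -> : K = ((fun x => dot x x) @^-1` [set 1]) `&`
    ((fun x => dot x e) @^-1` [set r | cos theta <= r]) by [].
apply: closedI; apply: preimage_closed.
- by move=> x _; exact: dot_continuous.
- exact: closed_eq.
- by move=> x _; exact: continuous_dot_r.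
- exact: closed_ge.
Qed.

Lemma cap_max_exists (f : V -> R) : (forall x, K x -> {for x, continuous f}) ->
  exists2 x, K x & forall y, K y -> f y <= f x.
Proof.
move=> cf; have [|x] := EVT_max_rV sphere_cap_nonempty sphere_cap_compact (f := f).
  by apply: continuous_in_subspaceT => x; rewrite inE => /cf.
by rewrite inE => Kx H; exists x => // y Ky; apply: H; rewrite inE.
Qed.

Lemma sphere_circ x v t : dot x x = 1 -> dot v v = 1 -> dot v x = 0 ->
  dot (circ 0 x v t) (circ 0 x v t) = 1.
Proof.
move=> xx vv vx; rewrite /circ add0r !dotE xx vv vx [dot x v]dotC vx.
by rewrite !mulr0 add0r addr0 !mulr1 -!expr2 cos2Dsin2.
Qed.

(** [e - cos theta *: x] is a positive multiple of the inward conormal; the great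
    circle leaving [x] in its direction stays in the cap. *)
Lemma cap_max_boundary (f : V -> R) x : K x -> dot x e = cos theta ->
  differentiable f x -> (forall y, K y -> f y <= f x) ->
  'D_(e - cos theta *: x) f x <= 0.
Proof.
move=> [xx _] xe df fx.
have s0 := sin_theta_gt0.
(* On this great circle the height is [cos (t - theta)]. *)
pose h := (sin theta)^-1 *: (e - cos theta *: x).
have cs : 1 - cos theta ^+ 2 = sin theta ^+ 2.
  by rewrite -(cos2Dsin2 theta); ring.
have hx : dot h x = 0.
  by rewrite /h !dotE [dot e x]dotC xe xx; ring.
have he : dot h e = sin theta.
  rewrite /h !dotE xe dot_e_last.
  have -> : 1 - cos theta * cos theta = sin theta ^+ 2 by rewrite -cs; ring.
  by rewrite expr2 mulrA mulVf ?mul1r // gt_eqF.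
have hh : dot h h = 1.
  rewrite {2}/h dotZr dotDr dotNr dotZr hx he mulr0 subr0 mulVf //.
  by rewrite gt_eqF.
have hE : e - cos theta *: x = sin theta *: h.
  by rewrite /h scalerA mulfV ?scale1r // gt_eqF.
clearbody h.
have H : 'D_h f (0 + x) <= 0.
  apply: (@circ_max1 _ _ f 0 x h theta); rewrite ?add0r //.
  move=> t /andP[t0 tt]; apply: fx; split; first exact: sphere_circ.
  rewrite /circ add0r dotDl !dotZl xe he.
  rewrite -cosB.
  have pt := theta_lt_pi.
  rewrite -[cos (t - theta)]cosN opprB ltW // ltr_cos.
  - by rewrite ltrBlDr ltrDl.
  - by rewrite in_itv /=; apply/andP; split; lra.
  - by rewrite in_itv /=; apply/andP; split; lra.
rewrite add0r in H.
by rewrite hE derive_dirZ // /GRing.scale /= pmulr_rle0.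
Qed.

Lemma cap_max_interior (U : set V) (f : V -> R) x v : open U -> cdiff 1 U f ->
  U x -> K x -> cos theta < dot x e -> (forall y, K y -> f y <= f x) ->
  dot v v = 1 -> dot v x = 0 -> 'D_v ('D_v f) x - 'D_x f x <= 0.
Proof.
move=> oU cf Ux [xx _] xe fx vv vx.
have near_e : \forall t \near (0 : R), cos theta < dot (circ 0 x v t) e.
  have [dc _] := @is_diff_circ _ _ 0 x v 0.
  have cc := differentiable_continuous dc.
  have cd := @continuous_dot_r e (circ 0 x v 0).
  have cdc := continuous_comp cc cd.
  apply: (cdc [set r | cos theta < r]); apply: open_nbhs_nbhs; split; first exact: open_gt.
  by rewrite /= circ0 add0r.
have [d /= d0 Hd] := (nbhs_ballP _ _).1 near_e.
have H : 'D_v ('D_v f) (0 + x) - 'D_x f (0 + x) <= 0.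
  apply: (@circ_max2 _ _ U f 0 x v d); rewrite ?add0r // => t td.
  apply: fx; split; first exact: sphere_circ.
  by apply/ltW/Hd; rewrite -ball_normE /= sub0r normrN.
by rewrite add0r in H.
Qed.

Lemma dot_le1 x v : dot x x = 1 -> dot v v = 1 -> dot x v <= 1.
Proof. by move=> xx vv; apply: le_trans (ler_norm _) _; exact: dot_unit_le1. Qed.

(** The cap is geodesically convex: it is the trace on the sphere of a
    convex cone. *)
Lemma direction_segment x y t : K x -> K y -> 0 <= t <= 1 ->
  punctured ((1 - t) *: x + t *: y) /\ K (direction ((1 - t) *: x + t *: y)).
Proof.
move=> [xx xe] [yy ye] /andP[t0 t1].
have c0 := cos_theta_gt0.
set z := _ + _.
have ze : cos theta <= dot z e.
  rewrite /z !dotE.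
  have H1 : (1 - t) * cos theta <= (1 - t) * dot x e by rewrite ler_wpM2l //; lra.
  have H2 : t * cos theta <= t * dot y e by rewrite ler_wpM2l.
  by lra.
have Pz : punctured z.
  rewrite /punctured /= dot_gt0; apply: contraTneq ze => ->.
  by rewrite dot0l -ltNge.
have z1 : nrm z <= 1.
  rewrite -(@expr_le1 _ 2) // ?nrm_sq ?powR_ge0 //.
  rewrite /z !dotE xx yy [dot y x]dotC.
  have H : t * (1 - t) * dot x y <= t * (1 - t) * 1.
    by rewrite ler_wpM2l ?dot_le1 // mulr_ge0 //; lra.
  by lra.
split => //; split; first exact: dot_direction.
rewrite dotZl mulrC ler_pdivlMr ?nrm_gt0 //.
by apply: le_trans ze; rewrite ler_piMr // ltW.
Qed.

End CapGeometry.

(** * Support functions of capillary hypersurfaces *)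

Lemma derive_affine (R : realType) (V : normedModType R) (f g h : V -> R)
    (b L : R) (x v : V) :
  derivable f x v -> derivable g x v -> derivable h x v ->
  'D_v (fun y => f y + b * g y - L * h y) x =
  'D_v f x + b * 'D_v g x - L * 'D_v h x.
Proof.
move=> df dg dh.
rewrite -[X in 'D_v X x]/((f + b *: g) - L *: h).
have dbg := @derivableZ _ _ _ g b x v dg.
have dLh := @derivableZ _ _ _ h L x v dh.
rewrite (deriveB (derivableD df dbg) dLh) (deriveD df dbg).
by rewrite (deriveZ b dg) (deriveZ L dh).
Qed.

Lemma derive_dirBZ (R : realType) (V : normedModType R) (g : V -> R)
    (x w u : V) (r : R) : differentiable g x ->
  'D_(w - r *: u) g x = 'D_w g x - r * 'D_u g x.
Proof.
by move=> dg; rewrite derive_dirD // -scaleNr derive_dirZ // /GRing.scale /= mulNr.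
Qed.

Lemma derive_dot_row (R : realType) (V : normedModType R) k (u : 'rV[R]_k)
    (g : 'I_k -> V -> R) (x v : V) :
  (forall j, derivable (g j) x v) ->
  'D_v (fun y => dot u (\row_j g j y)) x = dot u (\row_j 'D_v (g j) x).
Proof.
move=> dg; have -> : (fun y => dot u (\row_j g j y)) = \sum_j u 0 j *: g j.
  by apply/funext => y; rewrite fct_sumE; apply: eq_bigr => j _; rewrite mxE.
rewrite derive_sum; last by move=> j; exact: derivableZ.
by apply: eq_bigr => j _; rewrite mxE deriveZ.
Qed.

(** [F ((1 + r) l) = (1 + r) ^ k F l] is differentiated at [r = 0]. *)
Lemma homogeneous_euler (R : realType) n (k : R) (F : 'rV[R]_n -> R) (l : 'rV[R]_n) :
  homogeneous k F -> pos_cone l -> differentiable F l ->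
  \sum_i 'D_(basis_vec R i) F l * l 0 i = k * F l.
Proof.
move=> homF pl dF.
transitivity ('D_l F l).
  by rewrite (derive_dot l dF); apply: eq_bigr => i _; rewrite mxE mulrC.
have dF0 : differentiable F (l + (0 : R) *: l) by rewrite scale0r addr0.
have D1 := is_derive_line dF0; rewrite scale0r addr0 in D1.
rewrite -(derive_val (is_derive:=D1)).
have -> : 'D_(1 : R) (fun r : R => F (l + r *: l)) 0 =
    'D_(1 : R) (F l *: (fun r : R => (r + 1) `^ k)) 0.
  apply: near_eq_derive; near=> r.
  have r1 : 0 < r + 1.
    have : `|r| < 1.
      near: r; apply/nbhs_ballP; exists 1 => //= r.
      by rewrite -ball_normE /= sub0r normrN.
    by rewrite ltr_norml => /andP[]; lra.
  by rewrite -{1}(scale1r l) -scalerDl addrC homF // mulrC.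
have D2 : is_derive (0 : R) (1 : R) (fun r : R => r + 1) 1.
  by apply: is_derive_eq; rewrite addr0.
have d1 : 0 < (0 : R) + 1 by rewrite add0r.
have d2 : differentiable (fun r : R => r + 1) (0 : R) by apply/derivable1_diffP.
have dk := differentiable_powR k d2 d1.
rewrite (deriveZ (F l) (diff_derivable dk)) (derive_powR k (1 : R) d2 d1).
by rewrite (derive_val (is_derive:=D2)) add0r powR1 !mulr1 /GRing.scale /= mulrC.
Unshelve. all: by end_near. Qed.

Section SupportFunction.
Context {R : realType} {n : nat} (theta : R).
Hypotheses (theta_gt0 : 0 < theta) (theta_lt : theta < pi / 2).
Local Notation V := 'rV[R]_n.+1.
Local Notation e := (e_last R n).
Local Notation K := (@sphere_cap R n theta).
Local Notation c := (cos theta).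
Variables (U : set V) (S : V -> R).
(* [S] stands for the support function: the three relations say that [S], its
   first and its second derivatives have degrees one, zero and minus one. *)
Hypotheses (oU : open U) (cS : cdiff 2 U S).
Hypothesis euler : forall x, U x -> 'D_x S x = S x.
Hypothesis euler1 : forall x v, U x -> 'D_x ('D_v S) x = 0.
Hypothesis euler2 : forall x u v, U x -> 'D_x ('D_u ('D_v S)) x = - 'D_u ('D_v S) x.
Implicit Types (x y u v : V).

Let cS1 : cdiff 1 U S. Proof. exact: cdiffW. Qed.
Let cD v : cdiff 1 U ('D_v S). Proof. exact: cdiff_derive. Qed.
Let dS x : U x -> differentiable S x. Proof. exact: (cdiff_differentiable cS). Qed.
Let dD x v : U x -> differentiable ('D_v S) x.
Proof. exact: (cdiff_differentiable (cD v)). Qed.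
Let dDD x u v : U x -> differentiable ('D_u ('D_v S)) x.
Proof. exact: (cdiff_differentiable (cdiff_derive u (cD v))). Qed.

Section Positivity.
Hypothesis KU : forall y, punctured y -> K (direction y) -> U y.
Hypothesis radial : forall y, punctured y -> S y = nrm y * S (direction y).
Hypothesis S_neq0 : forall x, K x -> S x != 0.
Hypothesis boundary : forall x, K x -> dot x e = c -> 'D_e S x = 0.
Hypothesis convex : forall x v, K x -> dot v x = 0 -> v != 0 ->
  0 < 'D_v ('D_v S) x.
Hypothesis tangent_exists : forall x, K x ->
  exists2 v, dot v v = 1 & dot v x = 0.

Let K_U x : K x -> U x.
Proof.
by move=> [xx xe]; apply: KU; rewrite ?direction_unit // /punctured /= xx ltr01.
Qed.

(* At a negative maximum the conormal derivative on the boundary, respectively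
   the flat Hessian in the interior, has the wrong sign. *)
Let max_pos x : K x -> (forall y, K y -> S y <= S x) -> 0 < S x.
Proof.
move=> Kx maxx; have Ux := K_U Kx; have c0 := cos_theta_gt0 theta_gt0 theta_lt.
rewrite lt_neqAle eq_sym S_neq0 //= leNgt; apply/negP => S0.
have [_ xe] := Kx; move: (xe); rewrite le_eqVlt => /orP[/eqP/esym xe'|xe'].
  have := cap_max_boundary theta_gt0 theta_lt Kx xe' (dS Ux) maxx.
  rewrite derive_dirD -?scaleNr ?derive_dirZ //; try exact: dS.
  rewrite boundary // euler // add0r /GRing.scale /= mulNr oppr_le0.
  by rewrite pmulr_rge0 // leNgt S0.
have [v vv vx] := tangent_exists Kx.
have := cap_max_interior oU cS1 Ux Kx xe' maxx vv vx.
rewrite euler // => H.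
have v0 : v != 0 by rewrite -dot_eq0 vv oner_eq0.
by have := convex Kx vx v0; lra.
Qed.

(** [S] is positive at its maximum and has no zero; a negative value would produce
    a zero on the segment to the maximum point, which by homogeneity may be
    followed outside the sphere. *)
Lemma support_pos x : K x -> 0 < S x.
Proof.
move=> Kx; have [x0 K0 max0] := cap_max_exists (f := S) (fun x Kx =>
  differentiable_continuous (dS (K_U Kx))).
have S0 := max_pos K0 max0.
rewrite lt_neqAle eq_sym S_neq0 //= leNgt; apply/negP => Sx.
pose g (t : R) := S ((1 - t) *: x0 + t *: x).
have seg t : t \in `[0, 1] -> punctured ((1 - t) *: x0 + t *: x) /\
    K (direction ((1 - t) *: x0 + t *: x)).
  by rewrite in_itv /=; exact: direction_segment.
have cg : {within `[0, 1], continuous g}.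
  apply: derivable_within_continuous => t /seg [Pt Kt].
  have E r : (1 - r) *: x0 + r *: x = x0 + r *: (x - x0).
    by rewrite scalerBl scale1r scalerBr addrAC addrA.
  have -> : g = (fun r => S (x0 + r *: (x - x0))) by apply/funext => r; rewrite /g E.
  rewrite E in Pt Kt.
  by apply: ex_derive; apply: is_derive_line; apply/dS/KU.
have [|t tI gt] := IVT (v := 0) ler01 cg.
  rewrite /g subr0 subrr scale1r !scale0r scale1r addr0 add0r.
  by rewrite ge_min le_max (ltW Sx) (ltW S0) orbT.
have [Pt Kt] := seg t tI.
have := S_neq0 Kt; move: gt; rewrite /g radial // => /eqP.
by rewrite mulf_eq0 gt_eqF ?nrm_gt0 //= => ->.
Qed.

End Positivity.

Section TestFunction.
Hypothesis S_pos : forall x, U x -> 0 < S x.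
Variables (w : V) (b L a : R).

(** Maximising [|W| / S ^ a], with [W = grad S + beta S e] and maximum [L], amounts
    to maximising [|W| - L S ^ a].  Freezing the unit vector [w] in the direction
    of [W] at the maximum point, and using [w . W <= |W|], leaves this expression,
    with [b = beta (w . e)]; it is affine in [S] and its derivatives apart from the
    power. *)
Definition test_fun y : R := 'D_w S y + b * S y - L * S y `^ a.

Lemma cdiff_test : cdiff 1 U test_fun.
Proof.
have H1 := cdiffM oU (cdiff_cst 1 U b) cS1.
have H2 := cdiffM oU (cdiff_cst 1 U (- L)) (cdiff_powR a oU S_pos cS1).
have H3 := cdiffD oU (cdiffD oU (cD w) H1) H2.
by apply: cdiff_eq H3 => // y _; rewrite /test_fun mulNr.
Qed.

Lemma derive_test v y : U y -> 'D_v test_fun y =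
  'D_v ('D_w S) y + b * 'D_v S y - L * (a * S y `^ (a - 1) * 'D_v S y).
Proof.
move=> Uy.
rewrite -(derive_powR a v (dS Uy) (S_pos Uy)).
apply: derive_affine; [exact/diff_derivable/dD | exact/diff_derivable/dS |].
exact/diff_derivable/(differentiable_powR a (dS Uy) (S_pos Uy)).
Qed.

Lemma derive2_test v x : U x -> 'D_v ('D_v test_fun) x =
  'D_v ('D_v ('D_w S)) x + b * 'D_v ('D_v S) x -
  L * a * (S x `^ (a - 1) * 'D_v ('D_v S) x +
           (a - 1) * S x `^ (a - 1 - 1) * 'D_v S x ^+ 2).
Proof.
move=> Ux.
have d0 : derivable ('D_v S) x v by exact/diff_derivable/dD.
have dp : derivable (fun y => S y `^ (a - 1)) x v.
  exact/diff_derivable/(differentiable_powR (a - 1) (dS Ux) (S_pos Ux)).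
pose h y := S y `^ (a - 1) * 'D_v S y.
have dh : derivable h x v := derivableM dp d0.
have Eh : 'D_v h x = S x `^ (a - 1) * 'D_v ('D_v S) x +
    'D_v S x * ((a - 1) * S x `^ (a - 1 - 1) * 'D_v S x).
  by rewrite -(derive_powR (a - 1) v (dS Ux) (S_pos Ux)); exact: (deriveM dp d0).
have -> : 'D_v ('D_v test_fun) x =
    'D_v (fun y => 'D_v ('D_w S) y + b * 'D_v S y - (L * a) * h y) x.
  apply: near_eq_derive; apply: (near_open oU _ Ux) => y; rewrite inE => Uy.
  by rewrite derive_test // /h !mulrA.
have d1 : derivable ('D_v ('D_w S)) x v by exact/diff_derivable/dDD.
rewrite (derive_affine b (L * a) d1 d0 dh) Eh.
move: ('D_v ('D_v ('D_w S)) x) ('D_v ('D_v S) x) ('D_v S x) => p q r.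
by move: (S x `^ (a - 1)) (S x `^ (a - 1 - 1)) => t t'; ring.
Qed.

Hypothesis a_gt0 : 0 < a.

Let powS1 x : U x -> S x `^ (a - 1) = S x `^ a / S x.
Proof.
move=> /S_pos Sx; rewrite powRB ?powRr1 //; first exact: ltW.
by rewrite (gt_eqF Sx) implybT.
Qed.

Lemma test_max_boundary x : U x -> K x -> dot x e = c ->
  'D_e S x = 0 -> 'D_e ('D_w S) x = 0 -> (forall y, K y -> test_fun y <= test_fun x) ->
  a * (L * S x `^ a) <= b * S x.
Proof.
move=> Ux Kx xe Se Sew maxx; have c0 := cos_theta_gt0 theta_gt0 theta_lt.
have dt : differentiable test_fun x := cdiff_differentiable cdiff_test Ux.
have := cap_max_boundary theta_gt0 theta_lt Kx xe dt maxx.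
have N0 : S x != 0 by rewrite gt_eqF // S_pos.
rewrite (derive_test _ Ux) (derive_dirBZ e x c (dD w Ux)) (derive_dirBZ e x c (dS Ux)).
rewrite Sew (euler1 w Ux) Se (euler Ux) (powS1 Ux).
move: (S x) N0 (S x `^ a) => r r0 t H.
have : c * (a * (L * t) - b * r) <= 0.
  by apply: le_trans H; rewrite le_eqVlt; apply/orP; left; apply/eqP; field.
by rewrite pmulr_rle0 // subr_le0.
Qed.

(* The discarded term is the one with the square of [r = D_v S]; its sign comes
   from [a < 1]. *)
Let interior_algebra (A B T p q r d0 d1 al s sa s1 s2 : R) :
  A - B <= 0 -> A = T + b * q - L * a * (s1 * q + (a - 1) * s2 * r ^+ 2) ->
  B = d0 + b * d1 - L * (a * s1 * d1) -> T = p - al * q -> d0 = 0 -> d1 = s ->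
  s1 = sa / s -> s != 0 -> 0 <= L * a * ((1 - a) * s2 * r ^+ 2) ->
  p + (b - al - a * (L * sa) / s) * q <= b * s - a * (L * sa).
Proof.
move=> H EA EB ET E0 E1 E2 s0 P0; rewrite EA EB ET E0 E1 E2 in H.
rewrite -subr_le0; apply: le_trans H; rewrite -subr_ge0.
set X := (X in 0 <= X).
suff -> : X = L * a * ((1 - a) * s2 * r ^+ 2) by [].
by rewrite /X; field.
Qed.

(** The second derivative test along the great circle through [x] with velocity
    [v].  The third-order term is rewritten as a derivative of the Hessian of [S]
    in the tangential part of [w], plus a radial derivative that the homogeneity
    of [S] evaluates. *)
Lemma test_max_interior x v : 0 <= L -> a < 1 ->
  U x -> K x -> c < dot x e -> (forall y, K y -> test_fun y <= test_fun x) ->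
  dot v v = 1 -> dot v x = 0 ->
  'D_(w - dot w x *: x) ('D_v ('D_v S)) x +
    (b - dot w x - a * (L * S x `^ a) / S x) * 'D_v ('D_v S) x
  <= b * S x - a * (L * S x `^ a).
Proof.
move=> L0 a1 Ux Kx xe maxx vv vx.
have := cap_max_interior oU cdiff_test Ux Kx xe maxx vv vx.
have N0 : S x != 0 by rewrite gt_eqF // S_pos.
have E : 'D_v ('D_v ('D_w S)) x =
    'D_(w - dot w x *: x) ('D_v ('D_v S)) x - dot w x * 'D_v ('D_v S) x.
  have E1 : 'D_v ('D_v ('D_w S)) x = 'D_v ('D_w ('D_v S)) x.
    apply: near_eq_derive; apply: (near_open oU _ Ux) => y; rewrite inE => Uy.
    exact: (derive_comm_on w v oU cS1 Uy).
  rewrite [LHS]E1 [LHS](derive_comm_on w v oU (cD v) Ux).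
  have dvv := dDD v v Ux.
  rewrite [X in _ = X - _](derive_dirBZ w x (dot w x) dvv) (euler2 v v Ux).
  rewrite mulrN opprK addrK; reflexivity.
have P0 : 0 <= L * a * ((1 - a) * S x `^ (a - 1 - 1) * 'D_v S x ^+ 2).
  rewrite mulr_ge0 //; first by rewrite mulr_ge0 // ltW.
  apply: mulr_ge0; last exact: sqr_ge0.
  by apply: mulr_ge0; [rewrite subr_ge0 ltW | exact: powR_ge0].
move=> H; exact: (interior_algebra H (derive2_test v Ux) (derive_test x Ux) E
  (euler1 w Ux) (euler Ux) (powS1 Ux) N0 P0).
Qed.

End TestFunction.

(** Differentiating the boundary condition [D_e S = 0] along the boundary latitude
    shows that the conormal is a principal direction.  The vectors [w] with
    [dot w e = dot w x * c] are those orthogonal to the conormal [e - c x]; for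
    them this means [D_e (D_w S) = 0]. *)
Lemma boundary_principal x w : (forall y, K y -> U y) ->
  (forall y, K y -> dot y e = c -> 'D_e S y = 0) ->
  K x -> dot x e = c -> dot w e = dot w x * c -> 'D_e ('D_w S) x = 0.
Proof.
move=> KU bd Kx xe we; have [xx _] := Kx; have Ux := KU _ Kx.
rewrite (derive_comm_on _ _ oU cS1 Ux).
pose v := w - dot w x *: x.
have vx : dot v x = 0 by rewrite /v !dotE xx; ring.
have ve : dot v e = 0 by rewrite /v !dotE xe we; ring.
have wE : w = v + dot w x *: x by rewrite /v subrK.
clearbody v.
have dde : differentiable ('D_e S) x by exact: dD.
rewrite wE derive_dirD // derive_dirZ // euler1 // scaler0 addr0.
have [->|v0] := eqVneq v 0; first by rewrite derive0.
have vv0 : 0 < dot v v by rewrite dot_gt0.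
have cs : 1 - c ^+ 2 = sin theta ^+ 2 by rewrite -(cos2Dsin2 theta); ring.
have s0 := sin_theta_gt0 theta_gt0 theta_lt.
(* The tangent vector is rescaled to the radius of the latitude circle. *)
pose r := sin theta / nrm v.
have nv0 : 0 < nrm v by exact: nrm_gt0.
have r0 : r != 0 by rewrite mulf_neq0 ?invr_eq0 // gt_eqF.
pose u := r *: v.
have uu : dot u u = 1 - c ^+ 2.
  rewrite /u !dotE -nrm_sq cs /r; field.
  by rewrite gt_eqF.
have ux : dot u x = 0 by rewrite /u dotZl vx mulr0.
have ue : dot u e = 0 by rewrite /u dotZl ve mulr0.
suff : 'D_u ('D_e S) x = 0.
  rewrite /u derive_dirZ // => /eqP; rewrite /GRing.scale /= mulf_eq0 (negbTE r0) /=.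
  by move/eqP.
clearbody u.
have B : x = c *: e + (x - c *: e) by rewrite addrC subrK.
have H : 'D_u ('D_e S) (c *: e + (x - c *: e)) = 0.
  apply: (@circ_const _ _ _ _ _ u 0); first by rewrite -B.
  move=> t; have ee := @dot_e_last R n.
  have ye : dot (circ (c *: e) (x - c *: e) u t) e = c.
    by rewrite /circ !dotE ee xe ue; ring.
  apply: bd => //; split; last by rewrite ye.
  rewrite /circ !dotE ee xx [dot e x]dotC xe uu [dot e u]dotC ue [dot x u]dotC ux.
  transitivity (c ^+ 2 + (cos t ^+ 2 + sin t ^+ 2) * (1 - c ^+ 2)); first by ring.
  by rewrite cos2Dsin2; ring.
by rewrite -B in H.
Qed.

Section Linearisation.
Variables (F : 'rV[R]_n -> R) (f : V -> R).
Hypothesis smoothF : forall l : 'rV[R]_n, pos_cone l -> differentiable F l.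
Hypothesis KU : forall y, K y -> U y.
Hypothesis convex : forall x v, K x -> dot v x = 0 -> v != 0 ->
  0 < 'D_v ('D_v S) x.

Let frame (y : V) (p : ('I_n -> V) * 'rV[R]_n) :=
  (forall i, [/\ \row_j 'D_(p.1 i) ('D_(basis_vec R j) S) y = p.2 0 i *: p.1 i,
     dot (p.1 i) y = 0 & forall j, dot (p.1 i) (p.1 j) = (i == j)%:R]) /\
  F p.2 = f y.

Hypothesis solF : forall y, K y -> exists p, frame y p.

Let Hs y : 'M[R]_n.+1 :=
  \matrix_(i, j) 'D_(basis_vec R i) ('D_(basis_vec R j) S) y.

Let mulHs u y : U y -> u *m Hs y = \row_j 'D_u ('D_(basis_vec R j) S) y.
Proof.
move=> Uy; apply/rowP => j; rewrite [LHS]mxE [RHS]mxE (derive_dot u (dD _ Uy)).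
by apply: eq_bigr => i _; rewrite ![in LHS]mxE [in RHS]mxE.
Qed.

Let dotHs u v y : U y -> dot (u *m Hs y) v = 'D_u ('D_v S) y.
Proof. by move=> Uy; rewrite mulHs // dotC (dot_hess_row _ _ oU cS1 Uy). Qed.

Let symHs y : U y -> (Hs y)^T = Hs y.
Proof.
move=> Uy; apply/matrixP => i j; rewrite [LHS]mxE [LHS]mxE [RHS]mxE.
exact: (derive_comm_on _ _ oU cS1 Uy).
Qed.

Let dHs x v : 'M[R]_n.+1 :=
  \matrix_(i, j) 'D_v ('D_(basis_vec R i) ('D_(basis_vec R j) S)) x.

Let dot_dHs x u v : U x -> dot (u *m dHs x v) u = 'D_v ('D_u ('D_u S)) x.
Proof.
move=> Ux; rewrite -(dot_hess_row v u oU (cD u) Ux).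
have -> : \row_i 'D_v ('D_(basis_vec R i) ('D_u S)) x = u *m (dHs x v)^T.
  apply/rowP => i; rewrite [LHS]mxE [RHS]mxE.
  transitivity ('D_v (fun y => dot u (\row_j 'D_(basis_vec R i) ('D_(basis_vec R j) S) y)) x).
    apply: near_eq_derive; apply: (near_open oU _ Ux) => y; rewrite inE => Uy.
    by rewrite (dot_hess_row _ _ oU cS1 Uy).
  have d j : derivable ('D_(basis_vec R i) ('D_(basis_vec R j) S)) x v.
    exact/diff_derivable/dDD.
  rewrite (derive_dot_row u d).
  by apply: eq_bigr => j _; rewrite [in LHS]mxE [X in _ = _ * X]mxE [X in _ = _ * X]mxE.
rewrite /dot; under eq_bigr do rewrite mxE mulr_suml.
rewrite exchange_big /=; apply: eq_bigr => i _; rewrite mxE mulr_sumr.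
by apply: eq_bigr => j _; rewrite [in RHS]mxE; ring.
Qed.

(** The equation [F (tau s) = f], differentiated in a tangent direction [v].  The
    eigenframes along the curve [direction (x + t v)] in the cap, whose velocity
    at [x] is [v], are compared with a limit eigenframe at [x]. *)
Lemma linearised_equation x v : K x -> c < dot x e -> dot v x = 0 ->
  differentiable f x ->
  exists E : 'I_n -> V, exists l : 'rV[R]_n,
    [/\ forall i, [/\ dot (E i) x = 0, dot (E i) (E i) = 1
                    & 'D_(E i) ('D_(E i) S) x = l 0 i],
        pos_cone l, F l = f x
      & \sum_i 'D_(basis_vec R i) F l * 'D_v ('D_(E i) ('D_(E i) S)) x = 'D_v f x].
Proof.
move=> Kx xe vx df; have [xx _] := Kx; have Ux := KU Kx.
pose y (t : R) := direction (x + t *: v).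
have y0 : y 0 = x by rewrite /y scale0r addr0 direction_unit.
have Px : punctured x by rewrite /punctured /= xx ltr01.
have dd : differentiable direction x.
  by apply: differentiable_rV => j; exact: (cdiff_differentiable (cdiff_direction 0 j) Px).
have Dg : is_diff (0 : R) (fun r : R => x + r *: v) (cst 0 + ( *:%R^~ v)).
  exact: is_diffD.
have dl : differentiable (fun r : R => x + r *: v) (0 : R) by [].
have dd' : differentiable direction (x + (0 : R) *: v) by rewrite scale0r addr0.
have dy : differentiable y (0 : R) := differentiable_comp dl dd'.
have Dy : 'D_(1 : R) y 0 = v.
  rewrite /y (derive_chain _ dl dd') [X in 'D_X direction _]deriveE // diff_val.
  rewrite !fctE /= add0r scale1r scale0r addr0 derive_direction //.
  by rewrite direction_unit // nrm_unit // vx scale0r subr0 invr1 scale1r.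
have curve (g : V -> R) : differentiable g x ->
    is_derive (0 : R) (1 : R) (fun t => g (y t)) ('D_v g x).
  move=> dg; have dg' : differentiable g (y 0) by rewrite y0.
  have H := differentiable_comp dy dg'.
  apply: DeriveDef; first exact/derivable1_diffP.
  by rewrite (derive_chain _ dy dg') Dy y0.
have nK : \forall t \near (0 : R), K (y t).
  have n1 : \forall t \near (0 : R), punctured (x + t *: v).
    apply: (differentiable_continuous dl); rewrite scale0r addr0.
    exact: open_nbhs_nbhs (conj open_punctured Px).
  have n2 : \forall t \near (0 : R), c < dot (y t) e.
    have cc := differentiable_continuous dy.
    have cdc := continuous_comp cc (@continuous_dot_r _ _ e (y 0)).
    apply: (cdc [set r | c < r]); apply: open_nbhs_nbhs; split; first exact: open_gt.
    by rewrite /= y0.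
  apply: filterS2 n1 n2 => t Pt et; split; last exact: ltW.
  exact: dot_direction.
have /choice [p Hp] : forall t, exists q, K (y t) -> frame (y t) q.
  move=> t.
  have [Kt|nKt] := pselect (K (y t)); last by exists (fun=> 0, 0).
  by have [q Hq] := solF Kt; exists q.
have dA i j : is_derive (0 : R) (1 : R) (fun t => Hs (y t) i j) (dHs x v i j).
  have -> : (fun t => Hs (y t) i j) =
      (fun t => 'D_(basis_vec R i) ('D_(basis_vec R j) S) (y t)).
    by apply/funext => t; rewrite mxE.
  by rewrite mxE; apply: curve; exact: dDD.
have cy i : {for 0, continuous (fun t => y t 0 i)}.
  apply: differentiable_continuous.
  exact: (differentiable_comp dy (differentiable_coord _ _ _)).
have sA0 : (Hs (y 0))^T = Hs (y 0) by rewrite y0 symHs.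
have near_frame : \forall t \near 0^', (Hs (y t))^T = Hs (y t) /\ forall i,
     [/\ (p t).1 i *m Hs (y t) = (p t).2 0 i *: (p t).1 i, dot ((p t).1 i) (y t) = 0
       & forall j, dot ((p t).1 i) ((p t).1 j) = (i == j)%:R].
  apply: nbhs_dnbhs; apply: filterS nK => t Kt; split; first exact/symHs/KU.
  by move=> i; have [/(_ i)[H1 H2 H3] _] := Hp t Kt; rewrite mulHs //; exact: KU.
have [E0 [l0 [d [HE Hd HF]]]] := eigenvalues_perturbation dA cy sA0 near_frame.
rewrite y0 in HE.
have unitE i : dot (E0 i) (E0 i) = 1 by have [_ _ ->] := HE i; rewrite eqxx.
have eigE i : 'D_(E0 i) ('D_(E0 i) S) x = l0 0 i.
  by have [H1 _ _] := HE i; rewrite -dotHs // H1 dotZl unitE mulr1.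
have posl : pos_cone l0.
  move=> i; rewrite -eigE; apply: convex => //; first by have [] := HE i.
  by rewrite -dot_eq0 unitE oner_eq0.
have near_F : \forall t \near 0^', F (p t).2 = f (y t).
  by apply: nbhs_dnbhs; apply: filterS nK => t Kt; have [] := Hp t Kt.
have [F1 F2] := HF F _ _ (smoothF posl) (curve f df) near_F.
exists E0, l0; split => //; last 1 first.
- rewrite -F2 (derive_dot d (smoothF posl)); apply: eq_bigr => i _.
  by rewrite [X in _ = _ * X]mxE Hd dot_dHs // mulrC.
- by move=> i; split => //; have [] := HE i.
- by rewrite F1 y0.
Qed.

End Linearisation.

(** * The gradient estimate *)

Section GradientEstimate.
Hypothesis S_pos : forall x, U x -> 0 < S x.
Hypothesis KU : forall y, K y -> U y.
Hypothesis boundary : forall y, K y -> dot y e = c -> 'D_e S y = 0.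
Hypothesis convex : forall x v, K x -> dot v x = 0 -> v != 0 ->
  0 < 'D_v ('D_v S) x.
Variables (k p a C : R) (F : 'rV[R]_n -> R) (g : V -> R).
Hypotheses (a_gt0 : 0 < a) (a_lt1 : a < 1) (p_gt1 : 1 < p) (k_gt0 : 0 < k)
  (akp : a * k < p - 1) (C_ge0 : 0 <= C).
Hypotheses (curvF : curvature_function F) (homF : homogeneous k F).
Hypothesis g_pos : forall y, K y -> 0 < g y.
Hypothesis dg : forall y, K y -> differentiable g y.
Hypothesis g_bound : forall y v, K y -> dot v v <= 1 -> `|'D_v g y| <= C * g y.
Let f y := S y `^ (p - 1) * g y.
Hypothesis solF : forall y, K y -> exists q : ('I_n -> V) * 'rV[R]_n,
  (forall i, [/\ \row_j 'D_(q.1 i) ('D_(basis_vec R j) S) y = q.2 0 i *: q.1 i,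
     dot (q.1 i) y = 0 & forall j, dot (q.1 i) (q.1 j) = (i == j)%:R]) /\
  F q.2 = f y.

Let smoothF l : pos_cone l -> differentiable F l.
Proof. by move=> /(curv_smooth curvF [::]). Qed.

(** The coefficient for which [grad S + tilt S e] is orthogonal to the conormal on
    the boundary. *)
Definition tilt := c / sin theta ^+ 2.
Definition shifted_grad y : V := grad S y + (tilt * S y) *: e.
(** The summand [tilt / a] is what boundary points, and the trace of the linearised
    operator at interior points, require.  The other one comes from the equation at
    interior points, with [C] an upper estimate of the logarithmic derivative of [g]. *)
Definition ratio_bound := tilt / a + ((p - 1 + k) * (1 + tilt) + C) / (p - 1 - a * k).

Let tilt_ge0 : 0 <= tilt.
Proof. by rewrite divr_ge0 ?sqr_ge0 // ltW // cos_theta_gt0. Qed.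

Let tiltE : tilt * (1 - c ^+ 2) = c.
Proof.
have -> : 1 - c ^+ 2 = sin theta ^+ 2 by rewrite -(cos2Dsin2 theta); ring.
by rewrite mulfVK // expf_neq0 // gt_eqF // sin_theta_gt0.
Qed.

Let akp0 : 0 < p - 1 - a * k. Proof. by rewrite subr_gt0. Qed.

Lemma ratio_bound_ge0 : 0 <= ratio_bound.
Proof.
rewrite /ratio_bound addr_ge0 //; first by rewrite divr_ge0 // ltW.
rewrite divr_ge0 ?(ltW akp0) // addr_ge0 // mulr_ge0 //; last by rewrite addr_ge0.
by rewrite addr_ge0 // ?ltW // subr_gt0.
Qed.

Let dot_field u y : U y -> dot u (shifted_grad y) = 'D_u S y + tilt * dot u e * S y.
Proof.
move=> Uy; rewrite /shifted_grad dotDr dotZr -derive_dot; last exact: dS.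
by rewrite mulrAC.
Qed.

Let dot_unit_le_nrm (u v : V) : dot u u = 1 -> dot u v <= nrm v.
Proof.
move=> uu; have n0 : 0 <= nrm v by exact: powR_ge0.
have [uv|/ltW uv] := leP (dot u v) 0; first exact: le_trans uv n0.
rewrite -ler_sqr ?nnegrE // nrm_sq.
by have := dot_CauchySchwarz u v; rewrite uu mul1r.
Qed.

Let differentiable_f x : K x -> differentiable f x.
Proof.
move=> Kx; apply: differentiableM; last exact: dg.
exact: (differentiable_powR (p - 1) (dS (KU Kx)) (S_pos (KU Kx))).
Qed.

Let derive_f x v : K x ->
  'D_v f x = S x `^ (p - 1) / S x * ((p - 1) * g x * 'D_v S x + S x * 'D_v g x).
Proof.
move=> Kx; have Ux := KU Kx; have Sx := S_pos Ux.
have dp := differentiable_powR (p - 1) (dS Ux) Sx.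
have E := deriveM (diff_derivable (v := v) dp) (diff_derivable (v := v) (dg Kx)).
rewrite -[f]/((fun y => S y `^ (p - 1)) * g) E (derive_powR (p - 1) v (dS Ux) Sx).
have -> : S x `^ (p - 1 - 1) = S x `^ (p - 1) / S x.
  by rewrite powRB ?powRr1 ?(ltW Sx) // (gt_eqF Sx) implybT.
have N0 : S x != 0 by rewrite gt_eqF.
move: ('D_v S x) ('D_v g x) (S x `^ (p - 1)) => r1 r2 r3.
by rewrite /GRing.scale /=; field.
Qed.

(* The summed interior inequality is contradictory: [s] stands for [S], [rho] for
   the length of the gradient field, [P * G] for the right-hand side of the
   equation and [T] for the trace of the linearised operator. *)
Let final_algebra (s rho al b G G' T P : R) :
  0 < s -> 0 < P -> 0 < G -> `|al| <= 1 -> `|b| <= tilt -> `|G'| <= C * G ->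
  0 <= T -> tilt * s < a * rho ->
  ((p - 1 + k) * (1 + tilt) + C) * s < (p - 1 - a * k) * rho ->
  P / s * ((p - 1) * G * (rho - b * s - al * s) + s * G') +
    (b - al - a * rho / s) * (k * (P * G)) <= T * (b * s - a * rho) -> False.
Proof.
move=> s0 P0 G0 al1 bs G'C T0 H1 H2 H.
have bs' : b * s <= tilt * s.
  by rewrite ler_pM2r //; apply: le_trans bs; exact: ler_norm.
have H3 : T * (b * s - a * rho) <= 0.
  by rewrite mulr_ge0_le0 //; lra.
have {H H3} := le_trans H H3.
have N0 : s != 0 by rewrite gt_eqF.
have -> : P / s * ((p - 1) * G * (rho - b * s - al * s) + s * G') +
    (b - al - a * rho / s) * (k * (P * G)) =
  P / s * (G * ((p - 1 - a * k) * rho - s * ((p - 1) * (b + al) + k * (al - b))) + s * G').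
  by field.
have Ps : 0 < P / s by rewrite divr_gt0.
rewrite pmulr_rle0 // => H.
have H4 : - (C * G) <= G' by move: G'C; rewrite ler_norml => /andP[].
have H5 : s * - (C * G) <= s * G' by rewrite ler_pM2l.
have H6 : (p - 1) * (b + al) <= (p - 1) * (tilt + 1).
  rewrite ler_wpM2l //; first by rewrite subr_ge0 ltW.
  by apply: lerD; [apply: le_trans bs | apply: le_trans al1]; exact: ler_norm.
have H7 : k * (al - b) <= k * (tilt + 1).
  rewrite ler_wpM2l ?(ltW k_gt0) // addrC lerD //.
    by apply: le_trans bs; rewrite -normrN; exact: ler_norm.
  by apply: le_trans al1; exact: ler_norm.
have H8 : s * ((p - 1) * (b + al) + k * (al - b)) <=
    s * ((p - 1) * (tilt + 1) + k * (tilt + 1)) by rewrite ler_pM2l //; exact: lerD.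
move: H H8 H2; set Q := _ + k * (al - b); set X := (p - 1 - a * k) * rho => H H8 H2.
have E : ((p - 1 + k) * (1 + tilt) + C) * s =
    s * ((p - 1) * (tilt + 1) + k * (tilt + 1)) + s * C by ring.
have H9 : 0 < X - s * Q - s * C by lra.
have := mulr_gt0 G0 H9.
have -> : G * (X - s * Q - s * C) = G * (X - s * Q) + s * - (C * G) by ring.
by lra.
Qed.

(** The core of the estimate.  If [|shifted_grad| > ratio_bound * S] at the maximum point [x],
    then on the boundary the conormal derivative of the test function has the
    wrong sign.  In the interior the second derivative tests in the directions of
    the eigenframe are added with the positive weights [D_i F]: the third-order
    terms become the derivative of the right-hand side of the equation, the
    Hessian terms are evaluated by the homogeneity of [F], and the coefficient
    [p - 1 - a * k] of the dominant term is positive. *)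
Lemma field_at_max x L : K x -> 0 <= L ->
  (forall y, K y -> nrm (shifted_grad y) <= L * S y `^ a) ->
  nrm (shifted_grad x) = L * S x `^ a -> 0 < nrm (shifted_grad x) ->
  nrm (shifted_grad x) <= ratio_bound * S x.
Proof.
move=> Kx L0 Lmax Lx r0; rewrite leNgt; apply/negP => contra.
have [xx xe] := Kx; have Ux := KU Kx; have Sx := S_pos Ux.
have PW : punctured (shifted_grad x) by rewrite /punctured /= -nrm_sq exprn_gt0.
pose w := direction (shifted_grad x).
have ww : dot w w = 1 by exact: dot_direction.
have wE : nrm (shifted_grad x) *: w = shifted_grad x by exact: nrm_direction.
clearbody w.
pose b := tilt * dot w e.
have testE y : U y -> test_fun w b L a y = dot w (shifted_grad y) - L * S y `^ a.
  by move=> Uy; rewrite dot_field.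
have wx : dot w (shifted_grad x) = nrm (shifted_grad x) by rewrite -{1}wE dotZr ww mulr1.
have maxx y : K y -> test_fun w b L a y <= test_fun w b L a x.
  move=> Ky; rewrite (testE _ Ux) (testE _ (KU Ky)) wx Lx subrr subr_le0.
  exact: le_trans (dot_unit_le_nrm _ ww) (Lmax _ Ky).
have al1 : `|dot w x| <= 1 by exact: dot_unit_le1.
have bs : `|b| <= tilt.
  rewrite /b normrM ger0_norm // ler_piMr //; apply: dot_unit_le1 => //.
  exact: dot_e_last.
have bS : b * S x <= tilt * S x.
  by rewrite ler_pM2r //; apply: le_trans bs; exact: ler_norm.
have B1 : 0 <= tilt / a by rewrite divr_ge0 // ltW.
have B2 : 0 <= ((p - 1 + k) * (1 + tilt) + C) / (p - 1 - a * k).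
  rewrite divr_ge0 ?(ltW akp0) // addr_ge0 // mulr_ge0 //; last by rewrite addr_ge0.
  by rewrite addr_ge0 // ?(ltW k_gt0) // subr_ge0 ltW.
have H1 : tilt * S x < a * nrm (shifted_grad x).
  rewrite -ltr_pdivrMl // mulrA [a^-1 * _]mulrC; apply: le_lt_trans contra.
  by rewrite ler_pM2r // /ratio_bound; lra.
have H2 : ((p - 1 + k) * (1 + tilt) + C) * S x < (p - 1 - a * k) * nrm (shifted_grad x).
  rewrite -ltr_pdivrMl // mulrA [(p - 1 - a * k)^-1 * _]mulrC; apply: le_lt_trans contra.
  by rewrite ler_pM2r // /ratio_bound; lra.
move: xe; rewrite le_eqVlt => /orP[/eqP/esym xe|xe].
  have Se := boundary Kx xe.
  have We : dot w e = dot w x * c.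
    have r0' : nrm (shifted_grad x) != 0 by rewrite gt_eqF.
    apply: (mulfI r0').
    rewrite mulrA -!dotZl wE ![dot (shifted_grad x) _]dotC !(dot_field _ Ux) Se (euler Ux).
    have cE : c + tilt * c ^+ 2 = tilt by rewrite -[X in X + _]tiltE; ring.
    rewrite dot_e_last xe add0r mulr1.
    by rewrite -[X in X * S x = _]cE; ring.
  have Sew := boundary_principal KU boundary Kx xe We.
  have := test_max_boundary S_pos Ux Kx xe Se Sew maxx.
  by rewrite -Lx; lra.
pose v := w - dot w x *: x.
have vx : dot v x = 0 by rewrite /v !dotE xx; ring.
have vv : dot v v <= 1.
  rewrite /v !dotE xx ww [dot x w]dotC.
  by have := sqr_ge0 (dot w x); rewrite expr2; lra.
have [E [l [HE pl Fl sumE]]] :=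
  linearised_equation smoothF KU convex solF Kx xe vx (differentiable_f Kx).
have Fi i : 0 < 'D_(basis_vec R i) F l := curv_mono curvF i pl.
have ineq i : 'D_v ('D_(E i) ('D_(E i) S)) x +
    (b - dot w x - a * nrm (shifted_grad x) / S x) * l 0 i <= b * S x - a * nrm (shifted_grad x).
  have [Ex EE El] := HE i.
  have := test_max_interior S_pos a_gt0 L0 a_lt1 Ux Kx xe maxx EE Ex.
  by rewrite -Lx El.
have Fpos : 0 < S x `^ (p - 1) by exact: powR_gt0.
apply: (final_algebra Sx Fpos (g_pos Kx) al1 bs (g_bound Kx vv)
  (T := \sum_i 'D_(basis_vec R i) F l) _ H1 H2).
  by apply: sumr_ge0 => i _; exact: ltW.
have DvS : 'D_v S x = nrm (shifted_grad x) - b * S x - dot w x * S x.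
  rewrite /v (derive_dirBZ _ _ _ (dS Ux)) (euler Ux) -wx (dot_field _ Ux) /b.
  by rewrite addrK.
have Fl' : F l = S x `^ (p - 1) * g x := Fl.
rewrite -DvS -(derive_f v Kx) -sumE -Fl' -(homogeneous_euler homF pl (smoothF pl)).
rewrite mulr_sumr -big_split /= mulr_suml; apply: ler_sum => i _.
have -> : 'D_(basis_vec R i) F l * 'D_v ('D_(E i) ('D_(E i) S)) x +
   (b - dot w x - a * nrm (shifted_grad x) / S x) * ('D_(basis_vec R i) F l * l 0 i) =
   'D_(basis_vec R i) F l * ('D_v ('D_(E i) ('D_(E i) S)) x +
    (b - dot w x - a * nrm (shifted_grad x) / S x) * l 0 i).
  by rewrite mulrDr mulrCA.
by rewrite ler_pM2l.
Qed.

Let differentiable_field x : U x -> differentiable shifted_grad x.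
Proof.
move=> Ux; apply: differentiable_rV => j.
have -> : (fun y => shifted_grad y 0 j) =
    ('D_(basis_vec R j) S + (tilt * e 0 j) *: S : V -> R).
  apply/funext => y; transitivity ('D_(basis_vec R j) S y + tilt * S y * e 0 j).
    by rewrite [LHS]mxE [X in X + _]mxE [X in _ + X]mxE.
  by congr (_ + _); exact: mulrAC.
exact: (differentiableD (dD _ Ux) (differentiableZ (tilt * e 0 j) (dS Ux))).
Qed.

(** From the maximum point to all others: [S ^ (1 - a) <= M ^ (1 - a)] there. *)
Lemma field_bound M x : (forall y, K y -> S y <= M) -> K x ->
  nrm (shifted_grad x) <= ratio_bound * M `^ (1 - a) * S x `^ a.
Proof.
move=> SM Kx.
(* The maximised quantity is squared to be differentiable at zeros of the field. *)
pose q y := dot (shifted_grad y) (shifted_grad y) * (S y `^ (- a) * S y `^ (- a)).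
pose h y := nrm (shifted_grad y) / S y `^ a.
have h0 y : 0 <= h y by rewrite divr_ge0 // powR_ge0.
have hq y : h y ^+ 2 = q y.
  by rewrite /h /q exprMn nrm_sq powRN -expr2.
have dq y : K y -> {for y, continuous q}.
  move=> Ky; have Uy := KU Ky; apply: differentiable_continuous.
  have d1 : differentiable (fun v : V => dot v v) (shifted_grad y).
    exact: (cdiff_differentiable (cdiff_dot 0 openT)).
  have d2 := differentiable_comp (differentiable_field Uy) d1.
  have d3 := differentiable_powR (- a) (dS Uy) (S_pos Uy).
  exact: (differentiableM d2 (differentiableM d3 d3)).
have [x0 K0 max0] := cap_max_exists dq.
have S0 := S_pos (KU K0).
have hmax y : K y -> h y <= h x0.
  by move=> Ky; rewrite -ler_sqr ?nnegrE // !hq; exact: max0.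
have hE y : K y -> nrm (shifted_grad y) = h y * S y `^ a.
  by move=> Ky; rewrite /h mulfVK // gt_eqF //; exact/powR_gt0/S_pos/KU.
have M0 : 0 <= M `^ (1 - a) by exact: powR_ge0.
have hM : h x0 <= ratio_bound * M `^ (1 - a).
  have [f0|f0] := leP (nrm (shifted_grad x0)) 0.
    apply: (@le_trans _ _ 0); last by rewrite mulr_ge0 // ratio_bound_ge0.
    by rewrite /h mulr_le0_ge0 // invr_ge0 powR_ge0.
  have H : nrm (shifted_grad x0) <= ratio_bound * S x0.
    apply: (field_at_max K0 (h0 x0)) => //; last exact: hE.
    by move=> y Ky; rewrite hE // ler_wpM2r ?powR_ge0 // hmax.
  rewrite /h ler_pdivrMr ?powR_gt0 //; apply: (le_trans H).
  rewrite -mulrA ler_wpM2l ?ratio_bound_ge0 //.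
  have {1}-> : S x0 = S x0 `^ (1 - a) * S x0 `^ a.
    rewrite -powRD ?subrK ?powRr1 ?(ltW S0) //.
    by rewrite (gt_eqF S0) implybT.
  rewrite ler_wpM2r ?powR_ge0 //; apply: ge0_ler_powR => //.
  - by rewrite subr_ge0 ltW.
  - by rewrite nnegrE ltW.
  - by rewrite nnegrE (le_trans (ltW S0)) // SM.
  - exact: SM.
rewrite hE // ler_wpM2r ?powR_ge0 //.
exact: le_trans (hmax _ Kx) hM.
Qed.

Lemma grad_bound M x : (forall y, K y -> S y <= M) -> K x ->
  dot (grad S x) (grad S x) <=
    (2 * ratio_bound ^+ 2 + 2 * tilt ^+ 2) * (M `^ (2 - 2 * a) * S x `^ (2 * a)).
Proof.
move=> SM Kx; have Sx := S_pos (KU Kx).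
have MS := SM _ Kx; have M0 : 0 < M := lt_le_trans Sx MS.
have sqP (r t : R) : 0 < r -> r `^ (2 * t) = (r `^ t) ^+ 2.
  by move=> r0; rewrite mulrC powRrM powR_mulrn // powR_ge0.
have E2 : M `^ (2 - 2 * a) = (M `^ (1 - a)) ^+ 2.
  by rewrite -sqP //; congr (_ `^ _); ring.
rewrite E2 sqP //.
have H := field_bound SM Kx.
have H2 : dot (shifted_grad x) (shifted_grad x) <=
    ratio_bound ^+ 2 * ((M `^ (1 - a)) ^+ 2 * (S x `^ a) ^+ 2).
  rewrite -nrm_sq mulrA -!exprMn lerXn2r ?nnegrE ?powR_ge0 //.
  by rewrite !mulr_ge0 ?ratio_bound_ge0 // powR_ge0.
have S2 : S x ^+ 2 <= (M `^ (1 - a)) ^+ 2 * (S x `^ a) ^+ 2.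
  rewrite -exprMn lerXn2r ?nnegrE ?(ltW Sx) //.
    by rewrite mulr_ge0 // powR_ge0.
  have {1}-> : S x = S x `^ (1 - a) * S x `^ a.
    rewrite -powRD ?subrK ?powRr1 ?(ltW Sx) //.
    by rewrite (gt_eqF Sx) implybT.
  rewrite ler_wpM2r ?powR_ge0 //; apply: ge0_ler_powR => //.
  - by rewrite subr_ge0 ltW.
  - by rewrite nnegrE ltW.
  - by rewrite nnegrE ltW.
set Q := _ * (S x `^ a) ^+ 2 in H2 S2 *.
have H3 : tilt ^+ 2 * S x ^+ 2 <= tilt ^+ 2 * Q by rewrite ler_wpM2l ?sqr_ge0.
have gE : grad S x = shifted_grad x - (tilt * S x) *: e by rewrite /shifted_grad addrK.
rewrite gE; move: (shifted_grad x) H2 => W H2.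
have := dot_ge0 (W + (tilt * S x) *: e).
rewrite !dotDl !dotDr !dotNl !dotNr !dotZl !dotZr dot_e_last.
rewrite [dot e W]dotC.
move: (dot W e) (dot W W) H2 => t1 t2 H2 H4.
have E : t2 - tilt * S x * t1 + (- (tilt * S x * t1) -
   - (tilt * S x * (tilt * S x * 1))) = 2 * t2 + 2 * (tilt ^+ 2 * S x ^+ 2) -
   (t2 + tilt * S x * t1 + (tilt * S x * t1 + tilt * S x * (tilt * S x * 1))).
  by ring.
apply: (@le_trans _ _ (2 * t2 + 2 * (tilt ^+ 2 * S x ^+ 2))).
  by rewrite E gerBl.
have -> : (2 * ratio_bound ^+ 2 + 2 * tilt ^+ 2) * Q =
    2 * (ratio_bound ^+ 2 * Q) + 2 * (tilt ^+ 2 * Q) by ring.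
by rewrite lerD // ler_pM2l.
Qed.

End GradientEstimate.

End SupportFunction.

(** * From the capillary problem to its support function *)

Section LogDerivative.
Context {R : realType} {n : nat} (theta : R).
Local Notation V := 'rV[R]_n.+1.
Local Notation K := (@sphere_cap R n theta).

Lemma log_derivative_bound (U : set V) (g : V -> R) :
  cdiff 1 U g -> K `<=` U -> (forall y, K y -> 0 < g y) ->
  exists2 C, 0 <= C &
    forall y v, K y -> dot v v <= 1 -> `|'D_v g y| <= C * g y.
Proof.
move=> cg KU g0.
have dg y : K y -> differentiable g y.
  by move=> Ky; exact: (cdiff_differentiable cg (KU _ Ky)).
pose q y := dot (grad g y) (grad g y) * ((g y)^-1 * (g y)^-1).
have cq y : K y -> {for y, continuous q}.
  move=> Ky; have Uy := KU _ Ky; apply: differentiable_continuous.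
  have d0 : differentiable (grad g) y.
    apply: differentiable_rV => j.
    have -> : (fun z => grad g z 0 j) = 'D_(basis_vec R j) g.
      by apply/funext => z; rewrite mxE.
    exact: (cdiff_differentiable (cdiff_derive _ cg) Uy).
  have d1 : differentiable (fun v : V => dot v v) (grad g y).
    exact: (cdiff_differentiable (cdiff_dot 0 openT)).
  have d2 := differentiable_comp d0 d1.
  have N0 : g y != 0 by rewrite gt_eqF // g0.
  have d3 := differentiableV (dg _ Ky) N0.
  exact: (differentiableM d2 (differentiableM d3 d3)).
have [x0 K0 max0] := cap_max_exists cq.
have q0 y : 0 <= q y by rewrite mulr_ge0 ?dot_ge0 // -expr2 sqr_ge0.
exists (1 + q x0) => [|y v Ky vv]; first by rewrite addr_ge0.
have gy := g0 _ Ky.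
rewrite -ler_sqr ?nnegrE ?mulr_ge0 ?addr_ge0 ?(ltW gy) // real_normK ?num_real //.
rewrite (derive_dot v (dg _ Ky)); apply: (le_trans (dot_CauchySchwarz _ _)).
have H1 : dot v v * dot (grad g y) (grad g y) <= dot (grad g y) (grad g y).
  by rewrite ler_piMl // dot_ge0.
apply: (le_trans H1).
have -> : dot (grad g y) (grad g y) = q y * g y ^+ 2.
  by rewrite /q; field; rewrite gt_eqF.
rewrite exprMn ler_wpM2r ?sqr_ge0 //; apply: (le_trans (max0 _ Ky)).
by have := sqr_ge0 (q x0); have := q0 x0; nra.
Qed.

End LogDerivative.

Section Assembly.
Context {R : realType} {n : nat} (theta : R).
Hypotheses (theta_gt0 : 0 < theta) (theta_lt : theta < pi / 2).
Local Notation V := 'rV[R]_n.+1.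
Local Notation e := (e_last R n).
Local Notation K := (@sphere_cap R n theta).
Local Notation c := (cos theta).
Variables (U : set V) (s : V -> R).
Hypotheses (oU : open U) (capU : cap theta `<=` U) (sU : smooth_on U s).
Local Notation S := (support_fun theta s).

Lemma cap_point_cap x : K (direction x) -> cap theta (cap_point theta x).
Proof. by move=> Kx; exists (direction x). Qed.

Lemma cone_sphere_cap x : punctured x -> K (direction x) -> support_cone theta U x.
Proof. by move=> Px Kx; split => //; apply: capU; exact: cap_point_cap. Qed.

Lemma sphere_cap_cone x : K x -> support_cone theta U x.
Proof.
move=> /[dup] Kx [xx _]; apply: cone_sphere_cap; last by rewrite direction_unit.
by rewrite /punctured /= xx ltr01.
Qed.

Lemma cap_point_unit x : dot x x = 1 -> cap_point theta x = x - c *: e.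
Proof. by move=> xx; rewrite /cap_point direction_unit. Qed.

Lemma support_unit x : dot x x = 1 -> S x = s (x - c *: e).
Proof. by move=> xx; rewrite /support_fun nrm_unit // mul1r cap_point_unit. Qed.

Lemma support_radial x : punctured x -> S x = nrm x * S (direction x).
Proof.
by move=> Px; rewrite [S (direction x)]support_unit // dot_direction.
Qed.

Lemma tau_support x v : K x -> dot v x = 0 ->
  'D_v ('D_v S) x = tau theta s (x - c *: e) v v.
Proof.
move=> Kx vx; have [xx _] := Kx; have Cx := sphere_cap_cone Kx.
rewrite -tau_sharpE -cap_point_unit // (tau_sharp_support oU sU Cx xx vx) dotC.
by rewrite (dot_hess_row _ _ (open_cone oU) (cdiff_support theta oU sU 1) Cx).
Qed.

(** With [mu = (c x - e) / sin theta] the outward conormal, [D_mu s = cot theta s]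
    says that the vertical component of the position vector [grad S] vanishes: the
    boundary of the hypersurface lies in the horizontal hyperplane. *)
Lemma robin_support x : robin theta s -> K x -> dot x e = c -> 'D_e S x = 0.
Proof.
move=> rob Kx xe; have [xx _] := Kx; have Cx := sphere_cap_cone Kx.
have s0 := sin_theta_gt0 theta_gt0 theta_lt.
have N0 : sin theta != 0 by rewrite gt_eqF.
have nz : normal theta (x - c *: e) = x by rewrite /normal subrK.
pose mu := (sin theta)^-1 *: (c *: x - e).
have cs : 1 - c ^+ 2 = sin theta ^+ 2 by rewrite -(cos2Dsin2 theta); ring.
have ee := @dot_e_last R n.
have mux : dot mu x = 0 by rewrite /mu !dotE xx [dot e x]dotC xe; ring.
have mue : dot mu e = - sin theta.
  rewrite /mu !dotE xe ee.
  have -> : c * c - 1 = - sin theta ^+ 2 by rewrite -cs; ring.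
  by field.
have H : outward_conormal theta (x - c *: e) mu.
  split; rewrite /tangent ?nz //.
  - by rewrite {2}/mu dotZr dotDr dotZr dotNr mux mue mulr0 sub0r opprK mulVf.
  - by move=> X Xx Xe; rewrite /mu !dotE ![dot _ X]dotC Xx Xe; ring.
  - by rewrite mue oppr_lt0.
have Bz : cap_boundary theta (x - c *: e).
  by split; [exists x | rewrite !dotE xe ee; ring].
have := rob _ _ Bz H.
have Px : punctured x by case: Cx.
rewrite -(cap_point_unit xx) => H1.
have nx := dot_nabla_normal theta s Px; rewrite (direction_unit xx) in nx.
rewrite (derive_support sU e Cx) (direction_unit xx) [dot e x]dotC xe dotC.
move: H1; rewrite /mu dotZr dotDr dotNr dotZr nx mulr0 sub0r => H1.
have -> : dot (nabla theta s (cap_point theta x)) e =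
    - (sin theta * ((sin theta)^-1 * - dot (nabla theta s (cap_point theta x)) e)).
  by field.
by rewrite H1; field.
Qed.

Section Solution.
Variables (k p : R) (F : 'rV[R]_n -> R) (phi : V -> R).
Hypotheses (hn : (1 <= n)%N) (p_gt1 : 1 < p).
Hypotheses (curvF : curvature_function F) (convex : strictly_convex theta s)
  (sol : solution theta p phi F s).
Hypothesis phi_pos : forall z, cap theta z -> 0 < phi z.

Let capK x : K x -> cap theta (x - c *: e).
Proof. by move=> Kx; exists x. Qed.

Lemma support_convex x v : K x -> dot v x = 0 -> v != 0 -> 0 < 'D_v ('D_v S) x.
Proof.
move=> Kx vx v0; rewrite tau_support //; apply: convex.2 => //; first exact: capK.
by rewrite /tangent /normal subrK.
Qed.

Lemma solution_frame x : K x -> exists q : ('I_n -> V) * 'rV[R]_n,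
  (forall i, [/\ \row_j 'D_(q.1 i) ('D_(basis_vec R j) S) x = q.2 0 i *: q.1 i,
     dot (q.1 i) x = 0 & forall j, dot (q.1 i) (q.1 j) = (i == j)%:R]) /\
  F q.2 = S x `^ (p - 1) * phi (x - c *: e).
Proof.
move=> Kx; have [xx _] := Kx; have Cx := sphere_cap_cone Kx.
have [l [E [tE oE eE]] Fl] := sol.1 _ (capK Kx).
have tE' i : dot (E i) x = 0.
  by have := tE i; rewrite /tangent /normal subrK.
exists (E, l); split=> [i|] /=; last by rewrite support_unit.
split => //.
by rewrite -(tau_sharp_support oU sU Cx xx (tE' i)) cap_point_unit // eE.
Qed.

(** At a zero of [s] the right-hand side of the equation would vanish, whereas [F]
    is positive on the positive cone. *)
Lemma support_neq0 x : K x -> S x != 0.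
Proof.
move=> Kx; have [[E l] /= [HE Fl]] := solution_frame Kx.
have posl : pos_cone l.
  move=> i; have [Ei Ex EE] := HE i.
  have -> : l 0 i = 'D_(E i) ('D_(E i) S) x.
    rewrite -(dot_hess_row _ _ (open_cone oU) (cdiff_support theta oU sU 1)
      (sphere_cap_cone Kx)) Ei dotZr EE eqxx mulr1 //.
  by apply: support_convex => //; rewrite -dot_eq0 EE eqxx oner_eq0.
apply: contraTneq (curv_pos curvF posl) => S0; rewrite Fl S0 powR0 ?mul0r ?ltxx //.
by rewrite gt_eqF // subr_gt0.
Qed.

Lemma tangent_vector x : K x -> exists2 v, dot v v = 1 & dot v x = 0.
Proof.
move=> Kx; have [[E l] /= [HE _]] := solution_frame Kx.
have [_ Ex EE] := HE (Ordinal hn).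
by exists (E (Ordinal hn)) => //; rewrite EE eqxx.
Qed.

Lemma solution_support_pos x : K x -> 0 < S x.
Proof.
apply: (support_pos theta_gt0 theta_lt (open_cone oU) (cdiff_support theta oU sU 2)).
- by move=> y Cy; rewrite (support_euler sU Cy) mul1r.
- exact: cone_sphere_cap.
- exact: support_radial.
- exact: support_neq0.
- by move=> y; apply: robin_support; exact: convex.1.
- exact: support_convex.
- exact: tangent_vector.
Qed.

End Solution.

End Assembly.

Theorem lemma3p1 (R : realType) (n : nat) (hn : (1 <= n)%N)
    (theta k p gamma : R)
    (hp1 : 1 < p) (hpk : p < k + 1)
    (htheta0 : 0 < theta) (htheta1 : theta < pi / 2)
    (hgamma0 : 0 < gamma) (hgamma1 : gamma < 2 * (p - 1) / k)
    (phi : 'rV[R]_n.+1 -> R)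
    (hphi : smooth_cap theta phi)
    (hphi_pos : forall z : 'rV[R]_n.+1, cap theta z -> 0 < phi z) :
  exists C0 : R,
    forall (F : 'rV[R]_n -> R) (s : 'rV[R]_n.+1 -> R),
      curvature_function F -> homogeneous k F ->
      smooth_cap theta s -> even_on_cap theta s -> strictly_convex theta s ->
      solution theta p phi F s ->
      forall z : 'rV[R]_n.+1, cap theta z ->
        dot (nabla theta s z) (nabla theta s z) / s z `^ gamma
          <= C0 * max_cap theta s `^ (2 - gamma).
Proof.
have k0 : 0 < k by lra.
pose a := gamma / 2.
have gE : 2 * a = gamma by rewrite /a; field.
have a0 : 0 < a by rewrite divr_gt0.
have akp : a * k < p - 1.
  by move: hgamma1; rewrite ltr_pdivlMr // -gE; lra.
have a1 : a < 1 by rewrite -(ltr_pM2r k0); lra.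
pose ce : 'rV[R]_n.+1 := cos theta *: e_last R n.
have [Up [oUp capUp sUp]] := hphi.
pose g (y : 'rV[R]_n.+1) := phi (y - ce).
pose Ug : set 'rV[R]_n.+1 := [set y | Up (y - ce)].
have cshift j : cdiff 1 setT (fun y : 'rV[R]_n.+1 => (y - ce) 0 j).
  apply: cdiff_eq (cdiffD openT (cdiff_coord 1 setT j) (cdiff_cst 1 setT (- ce 0 j))).
    exact: openT.
  by move=> y _; rewrite !mxE.
have oUg : open Ug.
  have -> : Ug = (fun y => y - ce) @^-1` Up by [].
  apply: open_comp => // y _; apply: differentiable_continuous.
  by apply: differentiable_rV => j; exact: (cdiff_differentiable (cshift j)).
have KUg : @sphere_cap R n theta `<=` Ug by move=> y Ky; apply: capUp; exists y.
have cg : cdiff 1 Ug g.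
  apply: (@cdiff_comp _ _ _ _ _ Up phi (fun y => y - ce)) => //.
    by move=> j; apply: cdiffS (cshift j).
  exact: smooth_on_cdiff.
have gpos y : sphere_cap theta y -> 0 < g y by move=> Ky; apply: hphi_pos; exists y.
have dg y : sphere_cap theta y -> differentiable g y.
  by move=> Ky; exact: (cdiff_differentiable cg (KUg _ Ky)).
have [C C0 gC] := log_derivative_bound cg KUg gpos.
exists (2 * ratio_bound theta k p a C ^+ 2 + 2 * tilt theta ^+ 2).
move=> F s curvF homF [U [oU capU sU]] _ convex sol z [x Kx <-].
have [xx _] := Kx; have Cx := sphere_cap_cone capU Kx.
have Spos0 := solution_support_pos htheta0 htheta1 oU capU sU hn hp1 curvF convex sol.
have nab := dot_nabla_normal theta s (Cx.1).
have gradx := grad_support sU Cx.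
rewrite (cap_point_unit theta xx) (direction_unit xx) in nab gradx.
have euler y : support_cone theta U y -> 'D_y (support_fun theta s) y = support_fun theta s y.
  by move=> Cy; rewrite (support_euler sU Cy) mul1r.
have euler1 := hess_support_radial oU sU (theta := theta).
have euler2 := third_support_radial oU sU (theta := theta).
have cS := cdiff_support theta oU sU 2.
have bd y := robin_support htheta0 htheta1 capU sU convex.1 (x := y).
have cv := support_convex oU capU sU convex.
have fr := solution_frame oU capU sU sol.
have SE y : sphere_cap theta y -> support_fun theta s y = s (y - ce).
  by case=> yy _; rewrite support_unit.
have oC := open_cone (theta := theta) oU.
have KC := sphere_cap_cone capU.
(* The rest holds for every function with the properties just collected. *)
move: (support_fun theta s) (support_cone theta U) SE Spos0 gradx euler euler1 euler2 cS bd cv fr oC KC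
  {Cx} => S Om SE Spos0 gradx euler euler1 euler2 cS bd cv fr oC KC.
(* Powers of [S] are differentiable where [S] is positive. *)
pose W := Om `&` [set y | 0 < S y].
have oW : open W.
  rewrite openE => y [Oy Sy]; apply: filterI; first exact: open_nbhs_nbhs (conj oC Oy).
  have cont := differentiable_continuous (cdiff_differentiable cS Oy).
  by apply: (cont [set r | 0 < r]); apply: open_nbhs_nbhs; split; [exact: open_gt |].
have WO : W `<=` Om by move=> y [].
have KW y : sphere_cap theta y -> W y by move=> Ky; split; [exact: KC | exact: Spos0].
have SM y : sphere_cap theta y -> S y <= max_cap theta s.
  move=> Ky; apply: ub_le_sup; last by exists (y - ce); [exists y | rewrite SE].
  have [x1 K1 max1] := cap_max_exists (fun x (Kx : sphere_cap theta x) =>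
    differentiable_continuous (cdiff_differentiable cS (KC _ Kx))).
  by exists (S x1) => _ [_ [v Kv <-] <-]; rewrite -SE //; exact: max1.
have := grad_bound htheta0 htheta1 oW (cdiffS WO cS) (fun y Wy => euler y (WO y Wy))
  (fun y v Wy => euler1 y v (WO y Wy)) (fun y u v Wy => euler2 y u v (WO y Wy))
  (fun y (Wy : W y) => Wy.2) KW bd cv a0 a1 hp1 k0 akp C0 curvF homF gpos dg gC fr SM Kx.
rewrite gE => H.
have Sx := Spos0 _ Kx.
rewrite -SE // ler_pdivrMr ?powR_gt0 // -mulrA; apply: le_trans H.
move: (nabla theta s (x - cos theta *: e_last R n)) gradx nab => N gradx nab.
rewrite gradx !dotE xx [dot x N]dotC nab !mulr0 addr0 add0r mulr1.
by rewrite lerDl -expr2 sqr_ge0.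
Qed.
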